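(* Let $\mathcal{M}=\mathcal{B}$ or $\mathcal{M}=\mathbb{A}$, let $H_{i_1j_1},\dots,H_{i_mj_m}\in\mathcal{M}$, and consider the bilinear system $$\frac{d}{dt}X(t)=\sum_{k=1}^m u_k(t)H_{i_kj_k}X(t),\qquad X(0)=X_0,$$ with piecewise constant real controls $u_k$, being a system of one of the three types (on $\mathrm{SO}(n)$, multi-agent, Markov chain) described in the context. The system is controllable if and only if its associated graph $\Gamma=(V,E)$ is connected, where $V=\{1,\dots,n\}$ and $E=\{(i_1,j_1),\dots,(i_m,j_m)\}$ (undirected, unweighted).
   Context: $e_i$ is the $i$th standard basis vector of $\mathbb{R}^n$, $'$ denotes transpose. $\mathcal{B}=\{\Omega_{ij}:1\le i<j\le n\}$ with $\Omega_{ij}=e_ie_j'-e_je_i'$, the standard basis of $\mathfrak{so}(n)$. $\mathbb{A}=\{A_{ij}:1\le i,j\le n\}$ with $A_{ij}=e_ie_j'+e_je_i'-e_ie_i'-e_je_j'$; the matrices $A_{ij}$ occurring in the system have $i\ne j$. $H_{ij}$ stands for $\Omega_{ij}$ or $A_{ij}$ according to $\mathcal{M}$. The systems of this form are: (i) $\mathcal{M}=\mathcal{B}$: $X(t)\in\mathrm{SO}(n)$, $n\ge 3$, $X_0=I$, with state space $\mathrm{SO}(n)$. (ii) $\mathcal{M}=\mathbb{A}$, multi-agent system: $X(t)\in\mathbb{R}^{n\times d}$, whose $i$th row is the state $x_i'$ of agent $i$ in $\mathbb{R}^d$, with state space $\mathbb{P}$ consisting of all $(x_1,\dots,x_n)\in(\mathbb{R}^d)^n$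 with $\sum_i x_i=0$, $x_i\neq x_j$ for $i\ne j$, and $\mathrm{span}\{x_1-x_2,\dots,x_1-x_n\}=\mathbb{R}^d$; the control of the pair $\{i,j\}$ is the reciprocal interaction between agents $i$ and $j$. (iii) $\mathcal{M}=\mathbb{A}$, controlled symmetric Markov chain: $X(t)=P(t)\in\mathbb{R}^n$ is the probability distribution, with state space the $(n-1)$-simplex $\Delta^{n-1}=\{(p_1,\dots,p_n):\sum_{i=1}^n p_i=1\}$. Controllable means that any state of the state space can be steered to any other in finite time (in case (i), that every element of $\mathrm{SO}(n)$ is reachable from $I$).
   Formalization: For agents, 0<d<n-1 is assumed (if d=n-1, P splits into two orientation classes; if d≥n, P is empty); for the Markov chain, n≥3 and the uniform distribution, a fixed point, is removed from the simplex; agent trajectories between states of P may pass through collisions x_i=x_j. *)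

(* Defs.v *)
From mathcomp Require Import all_boot all_order all_algebra.
From mathcomp Require Import all_classical all_reals all_analysis.

Set Implicit Arguments.
Unset Strict Implicit.
Unset Printing Implicit Defensive.

Import Order.TTheory GRing.Theory Num.Theory numFieldNormedType.Exports.

Local Open Scope classical_set_scope.
Local Open Scope ring_scope.

(* [delta_mx i j] is $e_i e_j'$. *)
Definition Omega (R : realType) (n : nat) (i j : 'I_n) : 'M[R]_n :=
  delta_mx i j - delta_mx j i.

Definition Amx (R : realType) (n : nat) (i j : 'I_n) : 'M[R]_n :=
  delta_mx i j + delta_mx j i - delta_mx i i - delta_mx j j.

Definition piecewise_constant (R : realType) (a b : R) (f : R -> R) : Prop :=
  exists2 s : seq R, itv_partition a b s &
    forall l : nat, (l < size s)%N ->
      exists c : R, {in `]nth b (a :: s) l, nth b (a :: s) l.+1[, forall t, f t = c}.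

(* As the controls jump, the differential equation is imposed off a finite set
   of times; together with continuity this is the usual notion of solution for
   piecewise constant controls. *)
Definition is_trajectory (R : realType) (n p m : nat) (H : 'I_m -> 'M[R]_n)
    (T : R) (u : 'I_m -> R -> R) (X : R -> 'M[R]_(n, p)) : Prop :=
  {within `[0, T], continuous X} /\
  exists D : seq R, forall t : R, t \in `]0, T[ -> t \notin D ->
    is_derive t (1 : R) X (\sum_(k < m) u k t *: (H k *m X t)).

(* [X] evolves in the ambient matrix space: only the two endpoints are
   prescribed. *)
Definition steerable (R : realType) (n p m : nat) (H : 'I_m -> 'M[R]_n)
    (x y : 'M[R]_(n, p)) : Prop :=
  exists (T : R) (u : 'I_m -> R -> R) (X : R -> 'M[R]_(n, p)),
    [/\ 0 <= T, forall k, piecewise_constant 0 T (u k),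
        is_trajectory H T u X, X 0 = x & X T = y].

Definition controllable_on (R : realType) (n p m : nat)
    (S : set 'M[R]_(n, p)) (H : 'I_m -> 'M[R]_n) : Prop :=
  forall x y, S x -> S y -> steerable H x y.

Definition controllable_from (R : realType) (n p m : nat)
    (S : set 'M[R]_(n, p)) (H : 'I_m -> 'M[R]_n) (x0 : 'M[R]_(n, p)) : Prop :=
  forall y, S y -> steerable H x0 y.

Definition SO_space (R : realType) (n : nat) : set 'M[R]_n :=
  [set Q | Q *m Q^T = 1%:M /\ \det Q = 1].

(* Row [i] of [X] is the state of agent [i]; the index [i0] in the last clause
   is the first agent. *)
Definition agent_space (R : realType) (n d : nat) : set 'M[R]_(n, d) :=
  [set X | [/\ \sum_(i < n) row i X = 0,
               forall i j : 'I_n, i != j -> row i X != row j X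
             & forall i0 : 'I_n, i0 = 0%N :> nat ->
                 span [seq row i0 X - row j X | j <- enum 'I_n & j != i0]
                   = fullv]].

(* The coordinates are only required to sum to 1, not to be nonnegative. *)
Definition simplex (R : realType) (n : nat) : set 'cV[R]_n :=
  [set p | \sum_(i < n) p i ord0 = 1].

(* An equilibrium for every control, since every [Amx R i j] has zero row sums. *)
Definition uniform_distr (R : realType) (n : nat) : 'cV[R]_n :=
  const_mx n%:R^-1.

Definition graph_adj (n m : nat) (e : 'I_m -> 'I_n * 'I_n) : rel 'I_n :=
  fun i j => [exists k, (e k == (i, j)) || (e k == (j, i))].

Definition graph_connected (n m : nat) (e : 'I_m -> 'I_n * 'I_n) : Prop :=
  forall i j : 'I_n, connect (graph_adj e) i j.

Arguments SO_space : clear implicits.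
Arguments agent_space : clear implicits.
Arguments simplex : clear implicits.
Arguments uniform_distr : clear implicits.

(* Main.v *)
Require Import Defs.
From mathcomp Require Import all_boot all_order all_algebra.
From mathcomp Require Import all_classical all_reals all_analysis.
From mathcomp Require Import fingroup perm ring lra.

Set Implicit Arguments.
Unset Strict Implicit.
Unset Printing Implicit Defensive.

Import Order.TTheory GRing.Theory Num.Theory numFieldNormedType.Exports.

Local Open Scope classical_set_scope.
Local Open Scope ring_scope.

(** Solving the system with constant controls on successive time intervals
multiplies the state on the left by exponentials exp(c H_k), and any finite
product of such exponentials, with c of either sign, is realised by piecewise
constant controls (steerable_monoid_gen).  Controllability therefore follows
once the group generated by these exponentials is transitive, and fails as soon
as some function of the state is conserved.

If the graph is disconnected, a connected component C supplies a conserved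
quantity.  In the symmetric case it is the sum of the rows of X with index in C
(component_row_Amx); in the skew case it is the sum of the squares of the
entries of one column of X with row index in C (steerable_Omega_energy).  Two
points of the state space on which it differs show that the system is not
controllable: for the rotations the identity and the matrix of a 3-cycle, for
the chains two vertices of the simplex, for the agents one configuration and
the same configuration with two agents exchanged.

If the graph is connected, the first task is to pass from the edges of the graph
to all pairs of indices, by composing along paths.  For SO(n) this is the
conjugation of a plane rotation by a quarter turn (givens_conj), and then Givens
elimination brings every element of SO(n) to the identity (reach_SO_id).

In the symmetric case exp(c A_ij) scales the direction e_i - e_j by a positive
factor and fixes its orthogonal complement.  That such scalings generate the
matrices of positive determinant on the hyperplane of vectors with sum zero is
usually read off from the Lie algebra; here the required elements are written as
explicit finite products, which rest on a computation with three agents i, j, k.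
Moving the vector e_i - e_k around a parallelogram with sides along e_i - e_j
and e_j - e_k, by four scalings whose determinants cancel, gives a map of
determinant one that fixes e_i - e_k, hence a shear (shear_of_scalings).  A
product of scalings along e_i - e_j and shears that multiplies e_i - e_k by s and
has determinant s differs from the scaling by s along e_i - e_k only by a further
shear (scaling_of_shears).  So the pair (i, k) becomes available as soon as
(i, j) and (j, k) are.  Next, shears with the common direction e_i - e_o multiply
by adding up their linear forms, and suitable sums are elementary row operations
on the rows other than row o (has_transvection); row o is determined by the
others.  Column elimination with these operations brings every injective
n x d matrix with zero column sums to one normal form when d < n - 1, the spare
row allowing each pivot to be made equal to one without scaling
(frames_transitive).  The agents are exactly of this type, and the Markov chain
is the case d = 1, after subtraction of the uniform distribution, which every
exp(c A_ij) fixes. *)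

(** * Curves of matrices *)

Lemma continuous_mxP (R : realType) (n p : nat) (X : R -> 'M[R]_(n, p)) :
  continuous X <-> forall i j, continuous (fun t => X t i j).
Proof.
split=> [cX i j t|cX t].
  exact: (continuous_comp (cX t) (@coord_continuous _ _ _ i j _)).
apply/cvgrPdist_le => /= eps eps0; near=> s.
rewrite [leLHS]/Num.Def.normr/= mx_normrE (bigmax_le _ (ltW eps0))//= => i _.
rewrite !mxE/=; move: i; near: s; apply: filter_forall => /= i.
exact: ((cvgrPdist_le _ _).1 (cX i.1 i.2 t)).
Unshelve. all: by end_near. Qed.

Lemma is_derive_mxP (R : realType) (n p : nat) (X : R -> 'M[R]_(n, p)) (t : R)
    (D : 'M[R]_(n, p)) :
  is_derive t (1 : R) X D
    <-> forall i j, is_derive t (1 : R) (fun s => X s i j) (D i j).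
Proof.
split=> [[dX DX] i j|dX].
  move/derivable_mxP: (dX) => dXij; apply: DeriveDef => //.
  by rewrite -DX derive_mx// mxE.
have {}dXij : derivable X t 1 by apply/derivable_mxP => i j; case: (dX i j).
apply: DeriveDef => //; apply/matrixP => i j.
by rewrite derive_mx// mxE; case: (dX i j).
Qed.

Lemma is_derive_mulmxr (R : realType) (n p q : nat) (E : R -> 'M[R]_(n, p))
    (t : R) (D : 'M[R]_(n, p)) (x : 'M[R]_(p, q)) :
  is_derive t (1 : R) E D -> is_derive t (1 : R) (fun s => E s *m x) (D *m x).
Proof.
move=> /is_derive_mxP dE; apply/is_derive_mxP => i j.
have -> : (fun s => (E s *m x) i j) = \sum_(k < p) (x k j \*: (fun s => E s i k)).
  by apply/funext => s; rewrite mxE fct_sumE; apply: eq_bigr => k _; rewrite mulrC.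
apply: is_derive_eq; rewrite mxE; apply: eq_bigr => k _.
by rewrite mulrC.
Qed.

Lemma is_derive_mulmxl (R : realType) (n p q : nat) (X : R -> 'M[R]_(p, q))
    (t : R) (D : 'M[R]_(p, q)) (g : 'M[R]_(n, p)) :
  is_derive t (1 : R) X D -> is_derive t (1 : R) (fun s => g *m X s) (g *m D).
Proof.
move=> /is_derive_mxP dX; apply/is_derive_mxP => i j.
have -> : (fun s => (g *m X s) i j) = \sum_(k < p) (g i k \*: (fun s => X s k j)).
  by apply/funext => s; rewrite mxE fct_sumE.
by apply: is_derive_eq; rewrite mxE; apply: eq_bigr.
Qed.

(** The two flows used below have this shape: an identity plus scalar functions of
time times fixed matrices. *)
Lemma is_derive_curve (R : realType) (n : nat) (K A B : 'M[R]_n) (f g : R -> R)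
    (c df dg : R) :
  is_derive c (1 : R) f df -> is_derive c (1 : R) g dg ->
  is_derive c (1 : R) (fun s => K + f s *: A + g s *: B) (df *: A + dg *: B).
Proof.
move=> dF dG; apply/is_derive_mxP => i j.
have -> : (fun s => (K + f s *: A + g s *: B) i j)
    = cst (K i j) + (A i j \*: f) + (B i j \*: g).
  by apply/funext => s; rewrite !mxE /= mulrC [g s * _]mulrC.
apply: is_derive_eq; rewrite add0r !mxE; congr (_ + _); exact: mulrC.
Qed.

Lemma continuous_mulmx (R : realType) (n p q : nat) (E : R -> 'M[R]_(n, p))
    (X : R -> 'M[R]_(p, q)) :
  continuous E -> continuous X -> continuous (fun t => E t *m X t).
Proof.
move=> /continuous_mxP cE /continuous_mxP cX; apply/continuous_mxP => i j t.
under eq_fun do rewrite mxE.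
apply: (cvg_big (op := +%R)) => [|k _]; first exact: add_continuous.
by apply: cvgM; [exact: cE|exact: cX].
Qed.

(** * Steering along one-parameter groups *)

(** The one-parameter group c |-> exp(c H), through its differential equation. *)
Definition is_flow (R : realType) (n : nat) (H : 'M[R]_n) (E : R -> 'M[R]_n) :=
  E 0 = 1%:M /\ forall c, is_derive c (1 : R) E (H *m E c).

Inductive monoid_gen (R : realType) (n : nat) (S : 'M[R]_n -> Prop) :
    'M[R]_n -> Prop :=
| monoid_gen1 : monoid_gen S 1%:M
| monoid_genM a g : S a -> monoid_gen S g -> monoid_gen S (a *m g).

Lemma monoid_gen_mul (R : realType) (n : nat) (S : 'M[R]_n -> Prop) g h :
  monoid_gen S g -> monoid_gen S h -> monoid_gen S (g *m h).
Proof.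
move=> + Gh; elim=> [|a {}g Sa _ IH]; first by rewrite mul1mx.
by rewrite -mulmxA; apply: monoid_genM.
Qed.

Lemma monoid_gen_inv (R : realType) (n : nat) (S : 'M[R]_n -> Prop) g :
  (forall a, S a -> exists2 b, S b & b *m a = 1%:M) ->
  monoid_gen S g -> exists2 h, monoid_gen S h & h *m g = 1%:M.
Proof.
move=> Sinv; elim=> [|a {}g Sa _ [h Gh hg]].
  by exists 1%:M; [exact: monoid_gen1|rewrite mul1mx].
have [b Sb ba] := Sinv a Sa; exists (h *m b).
  apply: monoid_gen_mul => //; rewrite -[b]mulmx1.
  by apply: monoid_genM => //; exact: monoid_gen1.
by rewrite -mulmxA (mulmxA b) ba mul1mx.
Qed.

Lemma piecewise_constant_append (R : realType) (T c : R) (f : R -> R) :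
  piecewise_constant 0 T f ->
  piecewise_constant 0 (T + 1) (fun t => if t < T then f t else c).
Proof.
move=> [s sT hs]; exists (rcons s (T + 1)).
  rewrite -cats1; apply: itv_partition_cat sT _.
  by apply: itv_partition1; rewrite ltrDl.
(* The last interval is ]T, T + 1[; the others lie to the left of T. *)
move=> l; rewrite size_rcons ltnS leq_eqVlt => /orP[/eqP ->|ls].
  have -> : nth (T + 1) (0 :: rcons s (T + 1)) (size s) = T.
    by rewrite -rcons_cons nth_rcons /= ltnSn; apply: itv_partition_nth_size sT.
  have -> : nth (T + 1) (0 :: rcons s (T + 1)) (size s).+1 = T + 1.
    by rewrite /= nth_rcons ltnn eqxx.
  by exists c => t; rewrite in_itv/= => /andP[Tt _]; rewrite ltNge (ltW Tt).
have [d hd] := hs l ls; exists d => t.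
have -> : nth (T + 1) (0 :: rcons s (T + 1)) l = nth T (0 :: s) l.
  rewrite -rcons_cons nth_rcons /= ltnS (ltnW ls).
  by apply: set_nth_default; rewrite /= ltnS ltnW.
have -> : nth (T + 1) (0 :: rcons s (T + 1)) l.+1 = nth T (0 :: s) l.+1.
  rewrite -rcons_cons nth_rcons /= ltnS ls.
  by apply: set_nth_default.
move=> tl; have := hd t tl; case: ifP => // /negbT; rewrite -leNgt => Tt.
move: tl; rewrite in_itv/= => /andP[_ tl].
have := @itv_partition_nth_le _ R 0 T s l.+1 ls sT.
by rewrite leNgt (le_lt_trans Tt tl).
Qed.

Section steering.
Variables (R : realType) (n m : nat) (H : 'I_m -> 'M[R]_n).
Variable E : 'I_m -> R -> 'M[R]_n.
Hypothesis flowE : forall k, is_flow (H k) (E k).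

(** Clamping the time glues the old trajectory to the new arc in a single formula, so
that continuity at [T] needs no argument of its own; only [T] joins the
exceptional times.  Running for one more unit of time with the constant control
[c] on [k] amounts to the exponential exp(c H_k), whatever the sign of [c]. *)
Lemma trajectory_append (p : nat) (T : R) (u : 'I_m -> R -> R)
    (X : R -> 'M[R]_(n, p)) (k : 'I_m) (c : R) :
  0 <= T -> continuous X ->
  (exists D : seq R, forall t : R, t \in `]0, T[ -> t \notin D ->
    is_derive t (1 : R) X (\sum_(j < m) u j t *: (H j *m X t))) ->
  let u' j t := if t < T then u j t else (j == k)%:R * c in
  let X' t := E k (c * Num.max (t - T) 0) *m X (Num.min t T) in
  [/\ continuous X', X' 0 = X 0, X' (T + 1) = E k c *m X T &
    exists D : seq R, forall t : R, t \in `]0, T + 1[ -> t \notin D ->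
    is_derive t (1 : R) X' (\sum_(j < m) u' j t *: (H j *m X' t))].
Proof.
move=> T0 cX [D dX] u' X'; have [E0 dE] := flowE k.
have X'l t : t <= T -> X' t = X t.
  move=> tT; rewrite /X' (max_idPr _) ?subr_le0// mulr0 E0 mul1mx.
  by rewrite (min_idPl _).
have X'r t : T <= t -> X' t = E k (c * (t - T)) *m X T.
  by move=> tT; rewrite /X' (max_idPl _) ?subr_ge0// (min_idPr _).
have dEc t : is_derive t (1 : R) (fun s => E k (c * (s - T)))
    (c *: (H k *m E k (c * (t - T)))).
  apply/is_derive_mxP => i j; rewrite mxE.
  have dg : is_derive t (1 : R) (fun s => c * (s - T)) c.
    have := is_deriveZ c (is_deriveB (is_derive_id t (1:R)) (is_derive_cst T t (1:R))).
    rewrite subr0 [_ *: _]mulr1; exact.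
  move/is_derive_mxP: (dE (c * (t - T))) => /(_ i j) dEij.
  have := @is_derive1_comp R (fun s => E k s i j) _ t _ _ dEij dg.
  by rewrite mulrC.
split.
- apply: continuous_mulmx => t; last first.
    apply: (@continuous_comp _ _ _ (fun s : R => Num.min s T) X); last exact: cX.
    exact: (@continuous_min R _ id (cst T) t (@cvg_id _ _) (@cvg_cst _ _ _ _ _)).
  apply: (@continuous_comp _ _ _ (fun s : R => c * Num.max (s - T) 0) (E k)).
    apply: cvgM; first exact: cvg_cst.
    apply: (@continuous_max R _ (fun s => s - T) (cst 0) t); last exact: cvg_cst.
    by apply: (@cvgB R R _ _ _ id (cst T)); [exact: cvg_id|exact: cvg_cst].
  apply/differentiable_continuous/derivable1_diffP.
  by have [] := dE (c * Num.max (t - T) 0).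
- exact: X'l.
- by rewrite X'r ?lerDl// addrAC subrr add0r mulr1.
exists (T :: D) => t; rewrite in_itv/= in_cons negb_or => /andP[t0 tT1] /andP[tT tD].
(* The derivative is local, so each side of T can be treated with its own
   formula. *)
case: (ltgtP t T) tT => // [tT|Tt] _.
- have -> : \sum_(j < m) u' j t *: (H j *m X' t)
      = \sum_(j < m) u j t *: (H j *m X t).
    by apply: eq_bigr => j _; rewrite /u' tT X'l// ltW.
  have := dX t; rewrite in_itv/= t0 tT => /(_ isT tD).
  apply: near_eq_is_derive; near=> s; rewrite X'l//; apply: ltW.
  by near: s; exact: lt_nbhsl.
- have -> : \sum_(j < m) u' j t *: (H j *m X' t)
      = (c *: (H k *m E k (c * (t - T)))) *m X T.
    rewrite (bigD1 k)//= big1 ?addr0 => [|j /negbTE jk].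
      by rewrite /u' eqxx mul1r ltNge (ltW Tt)/= X'r ?(ltW Tt)// -scalemxAl mulmxA.
    by rewrite /u' jk mul0r ltNge (ltW Tt)/= scale0r.
  apply: near_eq_is_derive (is_derive_mulmxr _ (dEc t)).
  near=> s; rewrite X'r//; apply: ltW.
  by near: s; exact: lt_nbhsr.
Unshelve. all: by end_near. Qed.

(** The induction keeps the trajectory continuous on the whole line, which is what
[trajectory_append] consumes. *)
Lemma steerable_monoid_gen (p : nat) (g : 'M[R]_n) (x : 'M[R]_(n, p)) :
  monoid_gen (fun a => exists k c, a = E k c) g -> steerable H x (g *m x).
Proof.
move=> Gg.
suff [T [u [X [T0 pu cX dX [X0 XT]]]]] : exists T u (X : R -> 'M[R]_(n, p)),
    [/\ 0 <= T, forall k, piecewise_constant 0 T (u k), continuous X,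
      exists D : seq R, forall t : R, t \in `]0, T[ -> t \notin D ->
        is_derive t (1 : R) X (\sum_(j < m) u j t *: (H j *m X t)) &
      X 0 = x /\ X T = g *m x].
  exists T, u, X; split => //; split => //.
  exact: continuous_subspaceT.
elim: Gg => [|_ {}g [k [c ->]] _ [T [u [X [T0 pu cX dX [X0 XT]]]]]].
  exists 0, (fun _ => cst 0), (cst x); split => //.
  - by move=> k; exists [::]; [split|].
  - by move=> t; exact: cvg_cst.
  - by exists [::] => t; rewrite in_itv/= => /andP[/lt_trans h /h]; rewrite ltxx.
  - by rewrite mul1mx.
have [cX' X'0 X'T dX'] := trajectory_append k c T0 cX dX.
exists (T + 1), (fun j t => if t < T then u j t else (j == k)%:R * c).
exists (fun t => E k (c * Num.max (t - T) 0) *m X (Num.min t T)); split.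
- by rewrite addr_ge0.
- by move=> j; exact: piecewise_constant_append.
- exact: cX'.
- exact: dX'.
- by rewrite X'0 X'T X0 XT mulmxA.
Qed.

End steering.

(** * Conserved quantities *)

(** The mean value theorem applies between consecutive exceptional times: the
interval is cut at each of them in turn. *)
Lemma constant_off_finite (R : realType) (D : seq R) (a b : R) (f : R -> R) :
  a <= b -> {within `[a, b], continuous f} ->
  (forall t, t \in `]a, b[ -> t \notin D -> is_derive t (1 : R) f 0) ->
  f a = f b.
Proof.
elim: D a b => [|x D IH] a b ab cf df.
  have [|c _] := @MVT_segment R f (cst 0) a b ab _ cf.
    by move=> t tab; exact: df.
  by rewrite mul0r => /eqP; rewrite subr_eq0 => /eqP.
have [/andP[ax xb]|xab] := boolP ((a < x) && (x < b)); last first.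
  apply: IH => // t tab tD; apply: df => //; rewrite in_cons negb_or tD andbT.
  by apply: contra xab => /eqP <-; move: tab; rewrite in_itv.
have sub (c d : R) : a <= c -> d <= b -> `[c, d] `<=` `[a, b].
  move=> ac db t /=; rewrite !in_itv/= => /andP[ct td].
  by rewrite (le_trans ac ct) (le_trans td db).
have cax := continuous_subspaceW (sub a x (lexx a) (ltW xb)) cf.
have cxb := continuous_subspaceW (sub x b (ltW ax) (lexx b)) cf.
have dax t : t \in `]a, x[ -> t \notin D -> is_derive t (1 : R) f 0.
  rewrite in_itv/= => /andP[at_ tx] tD.
  apply: df; first by rewrite in_itv/= at_ (lt_trans tx xb).
  by rewrite in_cons negb_or tD lt_eqF.
have dxb t : t \in `]x, b[ -> t \notin D -> is_derive t (1 : R) f 0.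
  rewrite in_itv/= => /andP[xt tb] tD.
  apply: df; first by rewrite in_itv/= tb (lt_trans ax xt).
  by rewrite in_cons negb_or tD gt_eqF.
exact: etrans (IH a x (ltW ax) cax dax) (IH x b (ltW xb) cxb dxb).
Qed.

(** [df X D] stands for the derivative of [f] at [X] in the direction [D]; it has to
vanish along every velocity that some control can produce. *)
Lemma steerable_invariant (R : realType) (n p m : nat) (H : 'I_m -> 'M[R]_n)
    (f : 'M[R]_(n, p) -> R) (df : 'M[R]_(n, p) -> 'M[R]_(n, p) -> R)
    (x y : 'M[R]_(n, p)) :
  continuous f ->
  (forall (X : R -> 'M[R]_(n, p)) t D, is_derive t (1 : R) X D ->
    is_derive t (1 : R) (fun s => f (X s)) (df (X t) D)) ->
  (forall X (v : 'I_m -> R), df X (\sum_(k < m) v k *: (H k *m X)) = 0) ->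
  steerable H x y -> f x = f y.
Proof.
move=> cf hdf df0 [T [u [X [T0 _ [cX [D dX]] <- <-]]]].
have cfX : {within `[0, T], continuous (f \o X)}.
  by move=> t; apply: (continuous_comp (cX t)); exact: cf.
have dfX t : t \in `]0, T[ -> t \notin D -> is_derive t (1 : R) (f \o X) 0.
  by move=> tT tD; rewrite -(df0 (X t) (u^~ t)); exact/hdf/dX.
exact: (constant_off_finite T0 cfX dfX).
Qed.

Lemma delta_mulmxE (R : pzRingType) (n p q : nat) (i : 'I_n) (j : 'I_p)
    (X : 'M[R]_(p, q)) a b : (delta_mx i j *m X) a b = (a == i)%:R * X j b.
Proof.
rewrite mxE (bigD1 j)//= mxE eqxx andbT big1 ?addr0// => l /negbTE lj.
by rewrite mxE lj andbF mul0r.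
Qed.

Lemma steerable_linear (R : realType) (n p m : nat) (H : 'I_m -> 'M[R]_n)
    (w : 'rV[R]_n) (x y : 'M[R]_(n, p)) :
  (forall k, w *m H k = 0) -> steerable H x y -> w *m x = w *m y.
Proof.
move=> wH xy; apply/matrixP => i l; rewrite !ord1.
apply: (@steerable_invariant R n p m H (fun X => (w *m X) 0 l)
  (fun _ D => (w *m D) 0 l) x y _ _ _ xy).
- have -> : (fun X : 'M[R]_(n, p) => (w *m X) 0 l) = (fun X => \sum_a w 0 a * X a l).
    by apply/funext => X; rewrite mxE.
  apply: (continuous_big (op := +%R)) => [|a _ X]; first exact: add_continuous.
  have cX := @coord_continuous R n p a l X.
  exact: (continuous_comp cX (@mulrl_continuous R (w 0 a) _)).
- move=> X t D dX; have /is_derive_mxP := is_derive_mulmxl w dX; exact.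
- move=> X v; rewrite mulmx_sumr big1 ?mxE// => k _.
  by rewrite -scalemxAr mulmxA wH mul0mx scaler0.
Qed.

(** The weights are constant on the components of the graph, so the matrix of weights
commutes with each [Omega], and the weighted squared norm of a column is
conserved because [Omega] is skew. *)
Lemma steerable_Omega_energy (R : realType) (n p m : nat) (e : 'I_m -> 'I_n * 'I_n)
    (w : 'I_n -> R) (x y : 'M[R]_(n, p)) (l : 'I_p) :
  (forall k, w (e k).1 = w (e k).2) ->
  steerable (fun k => Omega R (e k).1 (e k).2) x y ->
  \sum_a w a * x a l ^+ 2 = \sum_a w a * y a l ^+ 2.
Proof.
move=> we xy.
apply: (@steerable_invariant R n p m _ (fun X => \sum_a w a * X a l ^+ 2)
  (fun X D => \sum_a w a * (X a l * D a l + X a l * D a l)) x y _ _ _ xy).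
- apply: (continuous_big (op := +%R)) => [|a _ X]; first exact: add_continuous.
  have cX := @coord_continuous R n p a l X.
  have cX2 := continuous_comp cX (@exprn_continuous R 2 _).
  exact: (continuous_comp cX2 (@mulrl_continuous R (w a) _)).
- move=> X t D /is_derive_mxP dX.
  have -> : (fun s => \sum_a w a * X s a l ^+ 2)
      = \sum_(a < n) (w a \*: ((fun s => X s a l) * (fun s => X s a l))).
    by apply/funext => s; rewrite fct_sumE; apply: eq_bigr => a _; rewrite expr2.
  exact: is_derive_sum (fun a => is_deriveZ (w a) (is_deriveM (dX a l) (dX a l))).
- move=> X v.
  under eq_bigr => a _ do rewrite -mulr2n -mulrnAl mulrA summxE mulr_sumr.
  rewrite exchange_big/= big1// => k _.
  have ZE a : (v k *: (Omega R (e k).1 (e k).2 *m X)) a l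
      = v k * ((a == (e k).1)%:R * X (e k).2 l - (a == (e k).2)%:R * X (e k).1 l).
    rewrite mxE; congr (_ * _); rewrite /Omega mulmxBl.
    have BE (A B : 'M[R]_(n, p)) : (A - B) a l = A a l - B a l by rewrite !mxE.
    by rewrite BE !delta_mulmxE.
  have deltaE (F : 'I_n -> R) z : \sum_a F a * (a == z)%:R = F z.
    by rewrite (bigD1 z)//= eqxx mulr1 big1 ?addr0// => a /negbTE ->; rewrite mulr0.
  pose c := v k * 2.
  transitivity (\sum_a ((w a * X a l * c * X (e k).2 l) * (a == (e k).1)%:R
      - (w a * X a l * c * X (e k).1 l) * (a == (e k).2)%:R)).
    by apply: eq_bigr => a _; rewrite ZE /c -[_ *+ 2]mulr_natr; ring.
  by rewrite sumrB !deltaE we; ring.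
Qed.

(** * Scalings along a difference of coordinates *)

Lemma AmxC (R : realType) (n : nat) (i j : 'I_n) : Amx R i j = Amx R j i.
Proof. by rewrite /Amx addrAC (addrC (delta_mx i j)) addrAC -!addrA [- _ - _]addrC. Qed.

Lemma AmxE (R : realType) (n : nat) (i j a b : 'I_n) :
  Amx R i j a b = - (((a == i)%:R - (a == j)%:R) * ((b == i)%:R - (b == j)%:R)).
Proof. by rewrite !mxE -!mulnb !natrM; ring. Qed.

Lemma Amx_sqr (R : realType) (n : nat) (i j : 'I_n) : i != j ->
  Amx R i j *m Amx R i j = -2 *: Amx R i j.
Proof.
move=> ij; have ji : j != i by rewrite eq_sym.
rewrite {1 2}/Amx !(mulmxBl, mulmxDl, mulmxBr, mulmxDr, mulNmx, mulmxN).
rewrite !mul_delta_mx_cond !eqxx (negbTE ij) (negbTE ji) !mulr0n !mulr1n.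
by apply/matrixP => a b; rewrite !mxE; ring.
Qed.

(** Multiplication by [s] of the direction e_i - e_j, its orthogonal complement being
fixed: [- Amx i j / 2] is the orthogonal projection onto that direction. *)
Definition scaling (R : realType) (n : nat) (i j : 'I_n) (s : R) : 'M[R]_n :=
  1%:M + ((1 - s) / 2) *: Amx R i j.

Lemma scalingC (R : realType) (n : nat) (i j : 'I_n) (s : R) :
  scaling i j s = scaling j i s.
Proof. by rewrite /scaling AmxC. Qed.

Lemma scalingE (R : realType) (n : nat) (i j a b : 'I_n) (s : R) :
  scaling i j s a b = (a == b)%:R
    + (s - 1) / 2 * (((a == i)%:R - (a == j)%:R) * ((b == i)%:R - (b == j)%:R)).
Proof. by rewrite mxE [X in X + _]mxE [X in _ + X]mxE AmxE; ring. Qed.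

Lemma scalingM (R : realType) (n : nat) (i j : 'I_n) (s t : R) : i != j ->
  scaling i j s *m scaling i j t = scaling i j (s * t).
Proof.
move=> ij.
rewrite /scaling mulmxDl mul1mx mulmxDr mulmx1 -scalemxAl -scalemxAr Amx_sqr// !scalerA.
rewrite -addrA -!scalerDl; congr (_ + _ *: _).
by field.
Qed.

Lemma scaling1 (R : realType) (n : nat) (i j : 'I_n) : scaling i j 1 = 1%:M :> 'M[R]_n.
Proof. by rewrite /scaling subrr mul0r scale0r addr0. Qed.

(** As the projection [- Amx / 2] has eigenvalues 0 and 1, exp(c A_ij) is the scaling
by exp(-2c). *)
Lemma Amx_flow (R : realType) (n : nat) (i j : 'I_n) : i != j ->
  is_flow (Amx R i j) (fun c => scaling i j (expR (-2 * c))).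
Proof.
move=> ij; split=> [|c].
  by rewrite mulr0 expR0 /scaling subrr mul0r scale0r addr0.
have df : is_derive c (1 : R) (fun s => (1 - expR (-2 * s)) / 2) (expR (-2 * c)).
  have dg : is_derive c (1 : R) (fun s => -2 * s) (-2).
    by have := is_deriveZ (-2) (is_derive_id c (1 : R)); rewrite [_ *: _]mulr1.
  have de := is_derive1_comp (is_derive_expR (-2 * c)) dg.
  have -> : (fun s : R => (1 - expR (-2 * s)) / 2)
      = 2^-1 \*: (cst 1 - (expR \o (fun s => -2 * s))).
    by apply/funext => s; rewrite mulrC.
  apply: (is_derive_eq
    (is_deriveZ 2^-1 (is_deriveB (is_derive_cst (1 : R) c (1 : R)) de))).
  have E : 2^-1 * (0 - expR (-2 * c) * -2) = expR (-2 * c) by field.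
  exact: E.
have := is_derive_curve 1%:M (Amx R i j) 0 df (is_derive_cst (0 : R) c (1 : R)).
have -> : (fun s => 1%:M + (1 - expR (-2 * s)) / 2 *: Amx R i j + cst 0 s *: 0)
    = (fun s => scaling i j (expR (-2 * s))).
  by apply/funext => s; rewrite scaler0 addr0.
suff -> : expR (-2 * c) *: Amx R i j + 0 *: 0 = Amx R i j *m scaling i j (expR (-2 * c)).
  by [].
rewrite scaler0 addr0 mulmxDr mulmx1 -scalemxAr Amx_sqr// scalerA.
rewrite -[X in _ = X + _]scale1r -scalerDl.
by congr (_ *: _); field.
Qed.

(** * Scalings and shears of three agents *)

(** The matrices 1 + B M B' are closed under product and multiply through their small
middle factor [M]; only the Gram matrix of [B] matters.  This turns the identities
between n x n matrices below into identities between 2 x 2 ones. *)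
Lemma mulmx_update (R : comPzRingType) (n p : nat) (B : 'M[R]_(n, p)) (M N : 'M[R]_p) :
  (1%:M + B *m M *m B^T) *m (1%:M + B *m N *m B^T)
    = 1%:M + B *m (M + N + M *m (B^T *m B) *m N) *m B^T.
Proof.
rewrite mulmxDl mul1mx mulmxDr mulmx1 !mulmxDr !mulmxDl -!addrA; congr (_ + _).
by rewrite addrCA !mulmxA.
Qed.

Definition mx2 (R : pzRingType) (a b c d : R) : 'M[R]_2 :=
  \matrix_(i, j) if i == 0 then if j == 0 then a else b
                 else if j == 0 then c else d.

(** The middle matrix is the Gram matrix of the vectors e_i - e_j and e_j - e_k. *)
Lemma mx2_update (R : comPzRingType) (a b c d a' b' c' d' : R) :
  mx2 a b c d + mx2 a' b' c' d'
    + mx2 a b c d *m mx2 2 (-1) (-1) 2 *m mx2 a' b' c' d'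
  = mx2 (a + a' + (2 * a - b) * a' + (2 * b - a) * c')
        (b + b' + (2 * a - b) * b' + (2 * b - a) * d')
        (c + c' + (2 * c - d) * a' + (2 * d - c) * c')
        (d + d' + (2 * c - d) * b' + (2 * d - c) * d').
Proof.
apply/matrixP => i j; rewrite !mxE !big_ord_recl !big_ord0 !mxE.
rewrite !big_ord_recl !big_ord0 !mxE /= !addr0.
by case: (i == 0) => /=; case: (j == 0) => /=; ring.
Qed.

Section planar.
Variables (R : realType) (n : nat) (i j k : 'I_n).

Definition plane_mx : 'M[R]_(n, 2) :=
  \matrix_(a, c) if c == 0 then (a == i)%:R - (a == j)%:R
                 else (a == j)%:R - (a == k)%:R.

Definition planar (a b c d : R) : 'M[R]_n :=
  1%:M + plane_mx *m mx2 a b c d *m plane_mx^T.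

Lemma planarE (p q r t : R) a b :
  planar p q r t a b = (a == b)%:R
    + ((a == i)%:R - (a == j)%:R)
       * (p * ((b == i)%:R - (b == j)%:R) + q * ((b == j)%:R - (b == k)%:R))
    + ((a == j)%:R - (a == k)%:R)
       * (r * ((b == i)%:R - (b == j)%:R) + t * ((b == j)%:R - (b == k)%:R)).
Proof.
rewrite !mxE !big_ord_recl !big_ord0 !mxE !big_ord_recl !big_ord0 !mxE /=.
by ring.
Qed.

Hypotheses (ij : i != j) (jk : j != k) (ik : i != k).

Lemma plane_gram : plane_mx^T *m plane_mx = mx2 2 (-1) (-1) 2.
Proof.
have sumE (F : 'I_n -> R) (x y : 'I_n) :
    \sum_a F a * ((a == x)%:R - (a == y)%:R) = F x - F y.
  under eq_bigr do rewrite mulrBr.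
  have deltaE z : \sum_a F a * (a == z)%:R = F z.
    by rewrite (bigD1 z)//= eqxx mulr1 big1 ?addr0// => a /negbTE ->; rewrite mulr0.
  by rewrite sumrB !deltaE.
have ji : j != i by rewrite eq_sym. have kj : k != j by rewrite eq_sym.
have ki : k != i by rewrite eq_sym.
apply/matrixP => c d; rewrite !mxE.
under eq_bigr do rewrite !mxE.
case: (c == 0); case: (d == 0); rewrite sumE !eqxx ?(negbTE ij) ?(negbTE jk)
  ?(negbTE ik) ?(negbTE ji) ?(negbTE kj) ?(negbTE ki) /=; by ring.
Qed.

Lemma planarM (a b c d a' b' c' d' : R) :
  planar a b c d *m planar a' b' c' d'
  = planar (a + a' + (2 * a - b) * a' + (2 * b - a) * c')
           (b + b' + (2 * a - b) * b' + (2 * b - a) * d')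
           (c + c' + (2 * c - d) * a' + (2 * d - c) * c')
           (d + d' + (2 * c - d) * b' + (2 * d - c) * d').
Proof. by rewrite mulmx_update plane_gram mx2_update. Qed.

End planar.

(** Used to compare coefficients without unfolding the matrices. *)
Lemma eq_planar (R : realType) (n : nat) (i j k : 'I_n) (a b c d a' b' c' d' : R) :
  a = a' -> b = b' -> c = c' -> d = d' ->
  planar i j k a b c d = planar i j k a' b' c' d'.
Proof. by move=> -> -> -> ->. Qed.

(** The map 1 + t (e_i - e_k)(2 e_j - e_i - e_k)', which fixes e_i - e_k and moves
every vector in that direction. *)
Definition shear (R : realType) (n : nat) (i j k : 'I_n) (t : R) : 'M[R]_n :=
  \matrix_(a, b) ((a == b)%:R + t * (((a == i)%:R - (a == k)%:R)
    * (2 * (b == j)%:R - (b == i)%:R - (b == k)%:R))).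

Lemma scaling_planar12 (R : realType) (n : nat) (i j k : 'I_n) (s : R) :
  scaling i j s = planar i j k ((s - 1) / 2) 0 0 0.
Proof.
apply/matrixP => a b; rewrite planarE scalingE.
by ring.
Qed.

Lemma scaling_planar23 (R : realType) (n : nat) (i j k : 'I_n) (s : R) :
  scaling j k s = planar i j k 0 0 0 ((s - 1) / 2).
Proof.
apply/matrixP => a b; rewrite planarE scalingE.
by ring.
Qed.

Lemma scaling_planar13 (R : realType) (n : nat) (i j k : 'I_n) (s : R) :
  let c := (s - 1) / 2 in scaling i k s = planar i j k c c c c.
Proof.
apply/matrixP => a b; rewrite planarE scalingE.
by ring.
Qed.

Lemma shear_planar (R : realType) (n : nat) (i j k : 'I_n) (t : R) :
  shear i j k t = planar i j k (- t) t (- t) t.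
Proof. by apply/matrixP => a b; rewrite planarE !mxE; ring. Qed.

Lemma shearN (R : realType) (n : nat) (i j k : 'I_n) (t : R) :
  shear i j k (- t) = shear k j i t.
Proof. by apply/matrixP => a b; rewrite !mxE; ring. Qed.

Section triangle.
Variables (R : realType) (n : nat) (i j k : 'I_n).
Hypotheses (ij : i != j) (jk : j != k) (ik : i != k).

(** In the coordinates a = x_i - x_j, b = x_j - x_k of the plane spanned by e_i - e_j
and e_j - e_k, the vector e_i - e_k is (1, 1); a scaling along e_i - e_j moves a
point parallel to (2, -1) without changing the sign of a, one along e_j - e_k
parallel to (-1, 2) without changing the sign of b.  The four factors take
(1, 1) through (1 + 2r, 1 - r), (1 + r, 1 + r), (1 - r, 1 + 2r) and back, and their
determinants have product 1.  A map of determinant 1 that fixes (1, 1) is a shear.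
The parameter r^2 / (1 - r^2) runs over all nonnegative numbers. *)
Lemma shear_of_scalings (r : R) : 0 <= r < 1 ->
  shear i j k (r ^+ 2 / (1 - r ^+ 2))
  = scaling j k (1 + 2 * r)^-1 *m (scaling i j ((1 - r) / (1 + r))
    *m (scaling j k ((1 + r) / (1 - r)) *m scaling i j (1 + 2 * r))).
Proof.
move=> /andP[r0 r1]; have d1 : 1 + 2 * r != 0 by apply/eqP; lra.
have d2 : 1 + r != 0 by apply/eqP; lra.
have d3 : 1 - r != 0 by apply/eqP; lra.
have d4 : 1 - r ^+ 2 != 0.
  have -> : 1 - r ^+ 2 = (1 - r) * (1 + r) by ring.
  by rewrite mulf_neq0.
rewrite !(scaling_planar12 i j k) !(scaling_planar23 i j k) shear_planar.
rewrite !planarM//.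
by apply: eq_planar; field; rewrite ?d1 ?d2 ?d3 ?d4.
Qed.

(** In the same coordinates, and read from right to left after the last shear, which
fixes (1, 1), the factors take (1, 1) to (s, s): the scalings add 1/2, 1/2 and -1
times (2, -1), and the two shears between them add multiples of (1, 1) with total
s - 1.  The split of s - 1 between the two makes the product of the determinants
2, (2 + s)/2 and s/(2 + s) equal to s.  The scaling by s along e_i - e_k does the
same to (1, 1) and has the same determinant, so that the quotient is a shear, and
this is the last factor. *)
Lemma scaling_of_shears (s : R) : 0 < s ->
  scaling i k s
  = scaling i j (s / (2 + s))
    *m (shear i j k (- ((s - 1) * (s + 2) / (3 * s)))
    *m (scaling i j ((2 + s) / 2)
    *m (shear i j k (4 * (s - 1) / (3 * s))
    *m (scaling i j 2
    *m shear i j k (- ((s - 1) * (2 * s - 3) / (6 * s))))))).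
Proof.
move=> s0; have d1 : s != 0 by apply/eqP; lra.
have d2 : 2 + s != 0 by apply/eqP; lra.
rewrite (scaling_planar13 i j k) !(scaling_planar12 i j k) !shear_planar !planarM//.
by apply: eq_planar; field; rewrite ?d1 ?d2.
Qed.

End triangle.

(** * Paths in the graph and successive elimination *)

(** A relation that holds along the edges and composes through an intermediate vertex
holds between the ends of every path.  The three vertices have to be distinct, so
the induction must allow the path to return to its origin. *)
Lemma connected_pairs (n m : nat) (e : 'I_m -> 'I_n * 'I_n) (P : 'I_n -> 'I_n -> Prop) :
  (forall k, P (e k).1 (e k).2) -> (forall i j, P i j -> P j i) ->
  (forall i j k, i != j -> j != k -> i != k -> P i j -> P j k -> P i k) ->
  graph_connected e -> forall i j, i != j -> P i j.
Proof.
move=> Pe Psym Ptrans conn i j; have /connectP[p pp ->] := conn i j.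
(* The case x = i covers the start and every return to it. *)
suff ind x : x = i \/ P i x -> path (graph_adj e) x p -> i != last x p ->
    P i (last x p) by apply: ind pp; left.
elim: p x {pp} => [|y p IH] x Pix /=.
  by move=> _ ix; case: Pix ix => [->|//]; rewrite eqxx.
move=> /andP[/existsP[k xy] yp]; apply: IH => //.
have Pxy : P x y by case/orP: xy => /eqP ek; have := Pe k; rewrite ek//= => /Psym.
have [->|iy] := eqVneq i y; [by left|right].
case: Pix => [xi|Pix]; first by rewrite -xi.
have [ix|ix] := eqVneq i x; first by rewrite ix.
have [<-//|xy'] := eqVneq x y.
exact: Ptrans Pix Pxy.
Qed.

(** The pattern of eliminating the entries of one column one after the other, each
step preserving what the earlier ones have achieved. *)
Lemma clear_all (T : eqType) (A : Type) (r : A -> A -> Prop) (inv : A -> Prop)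
    (zero : T -> A -> Prop) (s : seq T) (x : A) :
  (forall x, r x x) -> (forall x y z, r x y -> r y z -> r x z) ->
  (forall i x, i \in s -> inv x -> exists y, [/\ r x y, inv y, zero i y &
     forall j, j \in s -> j != i -> zero j x -> zero j y]) ->
  inv x -> exists y, [/\ r x y, inv y & forall i, i \in s -> zero i y].
Proof.
move=> r_refl r_trans step invx.
suff [y [xy invy zy]] : exists y, [/\ r x y, inv y & forall i, i \in undup s -> zero i y].
  by exists y; split=> // i si; apply: zy; rewrite mem_undup.
have : {subset undup s <= s} by move=> i; rewrite mem_undup.
elim: (undup s) (undup_uniq s) => [_ _|i t IH /= /andP[it ut] ts].
  by exists x; split.
have [|y [xy invy zy]] := IH ut; first by move=> j jt; apply: ts; rewrite in_cons jt orbT.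
have [|z [yz invz zi zj]] := step i y _ invy; first by apply: ts; rewrite mem_head.
exists z; split=> //; first exact: r_trans xy yz.
move=> j; rewrite in_cons; have [-> //|ji /= jt] := eqVneq j i.
by apply: zj => //; [apply: ts; rewrite in_cons jt orbT|apply: zy].
Qed.

(** * Transvections and elimination on matrices with zero column sums *)

Section transvections.
Variables (R : realType) (n : nat) (G : 'M[R]_n -> Prop).
Hypothesis (G1 : G 1%:M) (GM : forall g h, G g -> G h -> G (g *m h)).

Definition has_scalings (i j : 'I_n) : Prop := forall s : R, 0 < s -> G (scaling i j s).

Lemma has_scalingsC i j : has_scalings i j -> has_scalings j i.
Proof. by move=> h s s0; rewrite scalingC; apply: h. Qed.

(** Exchanging [i] and [k] inverts the sign of [t], which covers the negative
parameters. *)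
Lemma has_shears i j k (t : R) : i != j -> j != k -> i != k ->
  has_scalings i j -> has_scalings j k -> G (shear i j k t).
Proof.
wlog t0 : i k t / 0 <= t => [wlg ij jk ik Pij Pjk|].
  have [|/ltW t0] := leP 0 t; first by move/wlg; apply.
  rewrite -[t]opprK shearN; apply: wlg; rewrite ?oppr_ge0 1?eq_sym//;
    exact: has_scalingsC.
move=> ij jk ik Pij Pjk.
(* The solution of r^2 / (1 - r^2) = t in [0, 1[. *)
set r := Num.sqrt (t / (1 + t)).
have t1 : 0 < 1 + t by rewrite ltr_wpDr.
have r2 : r ^+ 2 = t / (1 + t) by rewrite sqr_sqrtr// divr_ge0// ltW.
have r0 : 0 <= r by exact: sqrtr_ge0.
have r1 : r < 1.
  by rewrite -(ltr_pXn2r (n := 2))// ?nnegrE// r2 expr1n ltr_pdivrMr// mul1r ltrDr.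
have -> : t = r ^+ 2 / (1 - r ^+ 2).
  by rewrite r2; field; rewrite (gt_eqF t1) /= addrK oner_eq0.
rewrite shear_of_scalings ?r0//.
apply: GM; first by apply: Pjk; rewrite invr_gt0; lra.
apply: GM; first by apply: Pij; apply: divr_gt0; lra.
apply: GM; first by apply: Pjk; apply: divr_gt0; lra.
by apply: Pij; lra.
Qed.

Lemma has_scalings_trans i j k : i != j -> j != k -> i != k ->
  has_scalings i j -> has_scalings j k -> has_scalings i k.
Proof.
move=> ij jk ik Pij Pjk s s0; rewrite (scaling_of_shears ij jk ik s0).
have Gsh t : G (shear i j k t) by exact: has_shears.
apply: GM; first by apply: Pij; apply: divr_gt0; lra.
apply: GM => //; apply: GM; first by apply: Pij; apply: divr_gt0; lra.
by apply: GM => //; apply: GM => //; apply: Pij.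
Qed.

Hypothesis Gscaling : forall i j, i != j -> has_scalings i j.

Definition transvection (u : 'cV[R]_n) (f : 'rV[R]_n) : 'M[R]_n := 1%:M + u *m f.

Lemma transvectionM u f g : f *m u = 0 ->
  transvection u f *m transvection u g = transvection u (f + g).
Proof.
move=> fu; rewrite /transvection mulmxDl mul1mx mulmxDr mulmx1 -!mulmxA.
by rewrite (mulmxA f) fu mul0mx mulmx0 addr0 mulmxDr -addrA [_ + u *m f]addrC.
Qed.

Lemma transvection_sum (I : finType) (P : pred I) (u : 'cV[R]_n) (f : I -> 'rV[R]_n) :
  (forall i, P i -> f i *m u = 0 /\ G (transvection u (f i))) ->
  G (transvection u (\sum_(i | P i) f i)).
Proof.
move=> fP; suff [] : (\sum_(i | P i) f i) *m u = 0
    /\ G (transvection u (\sum_(i | P i) f i)) by [].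
elim/big_ind: _ => [|x y [xu Gx] [yu Gy]|//].
  by rewrite mul0mx /transvection mulmx0 addr0.
by rewrite mulmxDl xu yu addr0 -transvectionM//; split=> //; apply: GM.
Qed.

(** Modulo the constant row, the linear form in this transvection is the coordinate
[j], so on matrices with zero column sums it adds [t] times row [j] to row [i] and
subtracts it from row [o].  It is a combination of the linear forms
2 e_l - e_i - e_o of the shears with direction e_i - e_o, for all [l] other than
[i] and [o]. *)
Lemma has_transvection (o i j : 'I_n) (t : R) : i != o -> j != o -> i != j ->
  G (transvection (delta_mx i 0 - delta_mx o 0)
       (t *: (delta_mx 0 j - n%:R^-1 *: const_mx 1))).
Proof.
move=> io jo ij; set u := _ - _.
have n0 : n%:R != 0 :> R by rewrite pnatr_eq0; case: (n) i {io ij u} => // -[].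
pose w l : 'rV[R]_n := 2 *: delta_mx 0 l - delta_mx 0 i - delta_mx 0 o.
pose c (l : 'I_n) : R := t / 2 * (l == j)%:R - t / (2 * n%:R).
have wu l : l != i -> l != o -> w l *m u = 0.
  move=> li lo; apply/matrixP => a b; rewrite !ord1 mulmxBr !mxE.
  have E z : \sum_a w l 0 a * delta_mx z (0 : 'I_1) a 0 = w l 0 z.
    rewrite (bigD1 z)//= [delta_mx _ _ _ _]mxE !eqxx mulr1 big1 ?addr0//.
    by move=> d /negbTE dz; rewrite [delta_mx _ _ _ _]mxE dz mulr0.
  rewrite !E /w !mxE !eqxx /= (eq_sym i l) (eq_sym o l) (negbTE li) (negbTE lo).
  rewrite (eq_sym o i) (negbTE io); ring.
have Gw l x : l != i -> l != o -> G (transvection u (x *: w l)).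
  move=> li lo; have := @has_shears i l o x _ _ io.
  rewrite eq_sym => /(_ li lo (Gscaling _) (Gscaling _)).
  suff -> : transvection u (x *: w l) = shear i l o x.
    by apply => //; rewrite eq_sym.
  apply/matrixP => a b; rewrite !mxE big_ord1 !mxE !eqxx /= !andbT.
  by rewrite /=; ring.
suff -> : t *: (delta_mx 0 j - n%:R^-1 *: const_mx 1)
    = \sum_(l | (l != i) && (l != o)) c l *: w l :> 'rV[R]_n.
  apply: transvection_sum => l /andP[li lo]; split; last exact: Gw.
  by rewrite -scalemxAl wu// scaler0.
(* The contributions of l = i and l = o make the full sum vanish. *)
have sumc : \sum_l c l = 0.
  rewrite sumrB sumr_const card_ord (bigD1 j)//= eqxx big1 ?addr0 => [|l /negbTE ->].
    by rewrite -[_ *+ n]mulr_natr /=; field.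
  by rewrite mulr0.
have sumc' : \sum_(l | (l != i) && (l != o)) c l = t / n%:R.
  move: sumc; rewrite (bigD1 i)//= (bigD1 o) ?(eq_sym o)//=.
  have -> : c i = - (t / (2 * n%:R)) by rewrite /c (negbTE ij) /=; ring.
  have -> : c o = - (t / (2 * n%:R)) by rewrite /c eq_sym (negbTE jo) /=; ring.
  move=> /eqP; rewrite addrA addr_eq0 => /eqP sumE.
  by apply: oppr_inj; rewrite -sumE; field.
apply/rowP => b; rewrite summxE.
have -> : \sum_(l | (l != i) && (l != o)) (c l *: w l) 0 b
    = ((b != i) && (b != o))%:R * (2 * c b) - ((b == i)%:R + (b == o)%:R) * (t / n%:R).
  rewrite -sumc' mulr_sumr.
  have -> : ((b != i) && (b != o))%:R * (2 * c b)
      = \sum_(l | (l != i) && (l != o)) 2 * c l * (b == l)%:R.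
    rewrite big_mkcond (bigD1 b)//= eqxx big1 ?addr0; last first.
      by move=> l /negbTE lb; rewrite (eq_sym b) lb mulr0 if_same.
    by case: ifP => _; rewrite ?mul1r ?mul0r ?mulr1.
  rewrite -sumrB; apply: eq_bigr => l _; rewrite !mxE !eqxx /=; ring.
rewrite !mxE eqxx /= /c.
have [->|bi] := eqVneq b i; first by rewrite (negbTE ij) (negbTE io) /=; ring.
have [->|bo] := eqVneq b o; first by rewrite eq_sym (negbTE jo) /=; ring.
by rewrite /=; field.
Qed.

Definition centered (p : nat) (X : 'M[R]_(n, p)) : Prop :=
  (const_mx 1 : 'rV[R]_n) *m X = 0.

Definition reach (p : nat) (X Y : 'M[R]_(n, p)) : Prop :=
  exists2 g, G g & g *m X = Y.

Lemma reach_refl p (X : 'M[R]_(n, p)) : reach X X.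
Proof. by exists 1%:M; rewrite ?mul1mx. Qed.

Lemma reach_trans p (X Y Z : 'M[R]_(n, p)) : reach X Y -> reach Y Z -> reach X Z.
Proof.
by move=> [g Gg <-] [h Gh <-]; exists (h *m g); [exact: GM|rewrite mulmxA].
Qed.

Lemma reach_row_add p (o i j : 'I_n) (t : R) (X : 'M[R]_(n, p)) :
  i != o -> j != o -> i != j -> centered X ->
  let Y := X + (delta_mx i 0 - delta_mx o 0) *m (t *: row j X) in
  [/\ reach X Y, centered Y &
    forall a l, a != o -> Y a l = X a l + (a == i)%:R * (t * X j l)].
Proof.
move=> io jo ij cX Y; split.
- exists (transvection (delta_mx i 0 - delta_mx o 0)
       (t *: (delta_mx 0 j - n%:R^-1 *: const_mx 1))); first exact: has_transvection.
  have fX : (delta_mx 0 j - n%:R^-1 *: const_mx 1) *m X = row j X.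
    by rewrite mulmxBl -scalemxAl cX scaler0 subr0 -rowE.
  by rewrite /transvection mulmxDl mul1mx -mulmxA -scalemxAl fX.
- rewrite /centered mulmxDr cX add0r mulmxA mulmxBr.
  suff E z : (const_mx 1 : 'rV[R]_n) *m delta_mx z (0 : 'I_1) = const_mx 1.
    by rewrite !E subrr mul0mx.
  apply/matrixP => a b; rewrite !ord1 !mxE (bigD1 z)//= !mxE !eqxx mul1r.
  by rewrite big1 ?addr0// => d /negbTE dz; rewrite !mxE dz mulr0.
- move=> a l ao; rewrite /Y !mxE big_ord1 !mxE eqxx !andbT (negbTE ao) subr0.
  by [].
Qed.

(** Linear independence of the columns, in the form that is invariant under invertible
row operations. *)
Definition trivial_ker (p : nat) (X : 'M[R]_(n, p)) : Prop :=
  forall v : 'cV[R]_p, X *m v = 0 -> v = 0.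

Hypothesis Ginv : forall g, G g -> exists2 h, G h & h *m g = 1%:M.

Lemma reach_sym p (X Y : 'M[R]_(n, p)) : reach X Y -> reach Y X.
Proof.
by move=> [g Gg <-]; have [h Gh hg] := Ginv Gg; exists h; rewrite // mulmxA hg mul1mx.
Qed.

Lemma reach_trivial_ker p (X Y : 'M[R]_(n, p)) :
  reach X Y -> trivial_ker X -> trivial_ker Y.
Proof.
move=> /reach_sym[h _ <-{X}] kX v Yv; apply: kX.
by rewrite -mulmxA Yv mulmx0.
Qed.

(** Row [o] is the one that the zero column sums determine, the rows [rho l] carry
the pivots, and [z] is a spare row. *)
Section frames.
Variables (d : nat) (o z : 'I_n) (rho : 'I_d -> 'I_n).
Hypotheses (rho_inj : injective rho) (rhoo : forall l, rho l != o).
Hypotheses (zo : z != o) (zrho : forall l, z != rho l).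

(** The first [k] columns agree with the normal form outside row [o]: column [l] is
the basis vector at [rho l]. *)
Definition reduced (k : nat) (X : 'M[R]_(n, d)) : Prop :=
  forall (l : 'I_d) a, (l < k)%N -> a != o -> X a l = (a == rho l)%:R.

Lemma centered_eq0 p (X : 'M[R]_(n, p)) :
  centered X -> (forall a b, a != o -> X a b = 0) -> X = 0.
Proof.
move=> cX X0; apply/matrixP => a b; rewrite mxE.
have [->|ao] := eqVneq a o; last exact: X0.
move/matrixP: cX => /(_ 0 b); rewrite !mxE (bigD1 o)//= mxE mul1r.
by rewrite big1 ?addr0// => c co; rewrite X0 ?mulr0.
Qed.

(** Otherwise column [l0] would be a combination of the columns already reduced. *)
Lemma exists_pivot (l0 : 'I_d) (X : 'M[R]_(n, d)) :
  centered X -> trivial_ker X -> reduced l0 X ->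
  exists i, [/\ i != o, forall l : 'I_d, (l < l0)%N -> i != rho l & X i l0 != 0].
Proof.
move=> cX kX redX; apply: contrapT => noi.
have X0 i : i != o -> (forall l : 'I_d, (l < l0)%N -> i != rho l) -> X i l0 = 0.
  by move=> io il; apply/eqP/negPn/negP => Xi; apply: noi; exists i.
(* The coefficients of the linear relation between column l0 and the reduced
   columns. *)
pose v : 'cV[R]_d := \col_l (if (l < l0)%N then - X (rho l) l0 else (l == l0)%:R).
suff /kX /matrixP /(_ l0 0) : X *m v = 0.
  by rewrite !mxE ltnn eqxx => /eqP; rewrite oner_eq0.
apply: centered_eq0 => [|a b ao]; first by rewrite /centered mulmxA cX mul0mx.
rewrite !ord1 mxE (bigD1 l0)//= mxE ltnn eqxx mulr1.
have termE l : l != l0 -> X a l * v l 0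
    = - (((l < l0)%N && (a == rho l))%:R * X (rho l) l0).
  move=> ll0; rewrite mxE; case: ifP => [ll|_]; last first.
    by rewrite (negbTE ll0) mulr0 mul0r oppr0.
  by rewrite redX// mulrN.
rewrite (eq_bigr _ termE) sumrN.
have [[l1 [l1l al1]]|nol] := pselect (exists l1 : 'I_d, (l1 < l0)%N /\ a = rho l1).
  rewrite (bigD1 l1)/=; last by apply: contraTneq l1l => ->; rewrite ltnn.
  rewrite l1l al1 eqxx mul1r big1 ?addr0 ?subrr// => l /andP[_ ll1].
  by rewrite (inj_eq rho_inj) eq_sym (negbTE ll1) andbF mul0r.
rewrite X0//; last by move=> l ll; apply/eqP => al; apply: nol; exists l.
rewrite big1 ?subrr// => l _.
have [ll|] := boolP (l < l0)%N; last by rewrite mul0r.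
by have [al|_] := eqVneq a (rho l); [case: nol; exists l|rewrite mul0r].
Qed.

(** No row can be rescaled.  Instead a nonzero entry is first brought to the spare row
[z], from where a multiple of it corrects the pivot to 1. *)
Lemma reach_reduced_column (l0 : 'I_d) (X : 'M[R]_(n, d)) :
  centered X -> trivial_ker X -> reduced l0 X ->
  exists Y, [/\ reach X Y, centered Y & reduced l0.+1 Y].
Proof.
move=> cX kX redX.
have keep (i j : 'I_n) t (A B : 'M[R]_(n, d)) : j != o ->
    (forall l : 'I_d, (l < l0)%N -> j != rho l) -> reduced l0 A ->
    (forall a l, a != o -> B a l = A a l + (a == i)%:R * (t * A j l)) -> reduced l0 B.
  move=> jo jr redA BE l a ll ao; rewrite BE// (redA l j)// (negbTE (jr l ll)).
  by rewrite !mulr0 addr0 redA.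
have [A [XA cA redA Az]] :
    exists A, [/\ reach X A, centered A, reduced l0 A & A z l0 != 0].
  have [Xz|Xz] := eqVneq (X z l0) 0; last by exists X; split => //; exact: reach_refl.
  have [i [io ir Xi]] := exists_pivot cX kX redX.
  have zi : z != i by apply: contra_neq Xi => <-.
  have [XA cA AE] := reach_row_add 1 zo io zi cX.
  eexists; split; [exact: XA|exact: cA|exact: keep AE|].
  by rewrite AE// eqxx Xz add0r !mul1r.
have zrho' l : rho l != z by rewrite eq_sym.
have [AB cB BE] :=
  reach_row_add ((1 - A (rho l0) l0) / A z l0) (rhoo l0) zo (zrho' l0) cA.
set B := A + _ in AB cB BE.
have redB : reduced l0 B by apply: keep BE.
have Bp : B (rho l0) l0 = 1 by rewrite BE// eqxx mul1r divfK// addrC subrK.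
have rholt (l : 'I_d) : (l < l0)%N -> rho l0 != rho l.
  by move=> ll; rewrite (inj_eq rho_inj); apply: contraTneq ll => ->; rewrite ltnn.
pose inv (Y : 'M[R]_(n, d)) := [/\ centered Y, reduced l0 Y & Y (rho l0) l0 = 1].
pose zero (i : 'I_n) (Y : 'M[R]_(n, d)) := Y i l0 = 0.
have step i Y : i \in [seq i <- enum 'I_n | (i != o) && (i != rho l0)] -> inv Y ->
    exists Z, [/\ reach Y Z, inv Z, zero i Z & forall j,
      j \in [seq i <- enum 'I_n | (i != o) && (i != rho l0)] -> j != i ->
      zero j Y -> zero j Z].
  rewrite mem_filter mem_enum andbT => /andP[io ip] [cY redY Yp].
  have [YZ cZ ZE] := reach_row_add (- Y i l0) io (rhoo l0) ip cY.
  eexists; split; first exact: YZ.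
  - split => //; first exact: keep ZE.
    by rewrite ZE// eq_sym (negbTE ip) mul0r addr0.
  - by rewrite /zero ZE// eqxx mul1r Yp mulr1 subrr.
  - move=> j; rewrite mem_filter => /andP[/andP[jo _] _] ji.
    by rewrite /zero ZE// (negbTE ji) mul0r addr0.
have [Y [BY [cY redY Yp] Y0]] :=
  clear_all (@reach_refl d) (@reach_trans d) step (And3 cB redB Bp).
exists Y; split => //; first exact: reach_trans (reach_trans XA AB) BY.
move=> l a; rewrite ltnS leq_eqVlt => /orP[/eqP/val_inj ->|ll] ao; last exact: redY.
have [->//|al] := eqVneq a (rho l0).
by apply: Y0; rewrite mem_filter ao al mem_enum.
Qed.

Lemma reach_reduced (X : 'M[R]_(n, d)) : centered X -> trivial_ker X ->
  exists Y, [/\ reach X Y, centered Y & reduced d Y].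
Proof.
move=> cX kX.
suff: forall k, (k <= d)%N -> exists Y, [/\ reach X Y, centered Y & reduced k Y] by apply.
elim=> [_|k IH kd]; first by exists X; split => //; exact: reach_refl.
have [Y [XY cY redY]] := IH (ltnW kd).
have [Z [YZ cZ redZ]] :=
  @reach_reduced_column (Ordinal kd) Y cY (reach_trivial_ker XY kX) redY.
by exists Z; split => //; exact: reach_trans XY YZ.
Qed.

(** The normal form is the same for both matrices, and reachability is symmetric. *)
Lemma frames_transitive (X Y : 'M[R]_(n, d)) :
  centered X -> trivial_ker X -> centered Y -> trivial_ker Y -> reach X Y.
Proof.
move=> cX kX cY kY.
have [X' [XX' cX' rX]] := reach_reduced cX kX.
have [Y' [YY' cY' rY]] := reach_reduced cY kY.
suff XY : X' = Y' by apply: reach_trans XX' _; rewrite XY; apply: reach_sym.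
apply/subr0_eq/centered_eq0 => [|a b ao].
  by rewrite /centered mulmxBr cX' cY' subrr.
by rewrite !mxE rX// rY// subrr.
Qed.

End frames.
End transvections.

(** * Plane rotations and Givens elimination *)

Lemma mulmx_ext (R : realType) (n : nat) (g h : 'M[R]_n) :
  (forall X : 'M[R]_n, g *m X = h *m X) -> g = h.
Proof. by move=> /(_ 1%:M); rewrite !mulmx1. Qed.

(** The rotation of the plane of [i] and [j] by an angle with cosine [c] and sine
[s]. *)
Definition givens (R : realType) (n : nat) (i j : 'I_n) (c s : R) : 'M[R]_n :=
  1%:M + (c - 1) *: (delta_mx i i + delta_mx j j) + s *: Omega R i j.

Lemma givens_mulE (R : realType) (n p : nat) (i j : 'I_n) (c s : R)
    (X : 'M[R]_(n, p)) a b :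
  (givens i j c s *m X) a b = X a b
    + (a == i)%:R * ((c - 1) * X i b + s * X j b)
    + (a == j)%:R * ((c - 1) * X j b - s * X i b).
Proof.
rewrite /givens /Omega !mulmxDl mul1mx -!scalemxAl mulmxDl mulmxBl.
have DE (A B : 'M[R]_(n, p)) : (A + B) a b = A a b + B a b by rewrite mxE.
have NE (A : 'M[R]_(n, p)) : (- A) a b = - A a b by rewrite mxE.
have ZE z (A : 'M[R]_(n, p)) : (z *: A) a b = z * A a b by rewrite mxE.
by rewrite !(DE, NE, ZE, delta_mulmxE); ring.
Qed.

Section givens.
Variables (R : realType) (n : nat).
Implicit Types (i j k : 'I_n) (c s : R).

Lemma givensM i j c s c' s' : i != j ->
  givens i j c s *m givens i j c' s' = givens i j (c * c' - s * s') (c * s' + s * c').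
Proof.
move=> ij; apply: mulmx_ext => X; rewrite -mulmxA; apply/matrixP => a b.
rewrite !givens_mulE !eqxx (eq_sym j) (negbTE ij).
have [->|ai] := eqVneq a i; first by rewrite (negbTE ij) /=; ring.
by have [->|aj] := eqVneq a j; rewrite /=; ring.
Qed.

Lemma tr_givens i j c s : (givens i j c s)^T = givens i j c (- s).
Proof.
apply/matrixP => a b; rewrite !mxE eq_sym -!mulnb !natrM; ring.
Qed.

Lemma givens10 i j : givens i j 1 0 = 1%:M :> 'M[R]_n.
Proof. by rewrite /givens subrr !scale0r !addr0. Qed.

Lemma Omega_flow i j : i != j ->
  is_flow (Omega R i j) (fun c => givens i j (cos c) (sin c)).
Proof.
move=> ij; have ji : j != i by rewrite eq_sym.
split=> [|c]; first by rewrite cos0 sin0 givens10.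
have df : is_derive c (1 : R) (fun s => cos s - 1) (- sin c).
  have := is_deriveB (is_derive_cos c) (is_derive_cst (1 : R) c (1 : R)).
  by rewrite subr0.
have := is_derive_curve 1%:M (delta_mx i i + delta_mx j j) (Omega R i j) df
  (is_derive_sin c).
suff -> : - sin c *: (delta_mx i i + delta_mx j j) + cos c *: Omega R i j
  = Omega R i j *m givens i j (cos c) (sin c) by [].
rewrite /givens /Omega !mulmxDr mulmx1 -!scalemxAr.
rewrite !(mulmxBl, mulmxDl, mulmxBr, mulmxDr, mulNmx, mulmxN).
rewrite !mul_delta_mx_cond.
rewrite !eqxx (negbTE ij) (negbTE ji) !mulr0n !mulr1n.
by apply/matrixP => a b; rewrite !mxE; ring.
Qed.

Lemma givens_orthogonal i j c s : i != j -> c ^+ 2 + s ^+ 2 = 1 ->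
  givens i j c s *m (givens i j c s)^T = 1%:M.
Proof.
move=> ij cs; rewrite tr_givens givensM// -(givens10 i j); congr givens.
  by rewrite mulrN opprK -!expr2 cs.
by rewrite mulrN [s * c]mulrC addNr.
Qed.

Lemma unit_circle c s : c ^+ 2 + s ^+ 2 = 1 ->
  exists t : R, c = cos t /\ s = sin t.
Proof.
move=> cs; have c1 : -1 <= c <= 1.
  rewrite -ler_norml -(ler_pXn2r (n := 2)) ?nnegrE// expr1n -normrX ger0_norm ?sqr_ge0//.
  by rewrite -cs lerDl sqr_ge0.
have s2 : Num.sqrt (1 - c ^+ 2) = `|s| by rewrite -cs addrAC subrr add0r sqrtr_sqr.
have [s0|s0] := leP 0 s.
  exists (acos c); rewrite acosK ?in_itv// sin_acos// s2 ger0_norm//.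
exists (- acos c); rewrite cosN sinN acosK ?in_itv// sin_acos// s2 ltr0_norm//.
by rewrite opprK.
Qed.

(** Orthogonality leaves 1 and -1, and the rotation by the half angle is a square
root, which makes the determinant nonnegative. *)
Lemma det_givens i j c s : i != j -> c ^+ 2 + s ^+ 2 = 1 ->
  \det (givens i j c s) = 1.
Proof.
move=> ij cs.
have d2 : \det (givens i j c s) ^+ 2 = 1.
  by rewrite expr2 -{2}det_tr -det_mulmx givens_orthogonal// det1.
have [t [ct st]] := unit_circle cs.
have d0 : 0 <= \det (givens i j c s).
  have -> : givens i j c s = givens i j (cos (t / 2)) (sin (t / 2))
      *m givens i j (cos (t / 2)) (sin (t / 2)).
    rewrite givensM// -cosD [cos _ * sin _ + _]addrC -sinD -splitr.
    by rewrite ct st.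
  by rewrite det_mulmx -expr2 sqr_ge0.
by move/eqP: d2; rewrite sqrf_eq1 => /orP[/eqP//|/eqP d1]; move: d0; rewrite d1 ler0N1.
Qed.

(** A quarter turn of the plane of [i] and [j] carries the plane of [j] and [k] to the
plane of [i] and [k]. *)
Lemma givens_conj i j k c s : i != j -> j != k -> i != k ->
  givens i k c s = givens i j 0 1 *m (givens j k c s *m givens i j 0 (-1)).
Proof.
move=> ij jk ik; apply: mulmx_ext => X; rewrite -!mulmxA; apply/matrixP => a b.
have [ji kj ki] : [/\ j != i, k != j & k != i] by split; rewrite eq_sym.
rewrite !givens_mulE !eqxx (negbTE ij) (negbTE jk) (negbTE ik).
rewrite (negbTE ji) (negbTE kj) (negbTE ki).
have [->|ai] := eqVneq a i; first by rewrite (negbTE ij) (negbTE ik) /=; ring.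
have [->|aj] := eqVneq a j; first by rewrite (negbTE jk) /=; ring.
by have [->|ak] := eqVneq a k; rewrite /=; ring.
Qed.

Lemma givensC i j c s : givens j i c s = givens i j c (- s).
Proof. by apply/matrixP => a b; rewrite !mxE -!mulnb !natrM; ring. Qed.

Variable (G : 'M[R]_n -> Prop).
Hypothesis (G1 : G 1%:M) (GM : forall g h, G g -> G h -> G (g *m h)).

Definition has_rotations i j : Prop :=
  forall c s, c ^+ 2 + s ^+ 2 = 1 -> G (givens i j c s).

Lemma has_rotationsC i j : has_rotations i j -> has_rotations j i.
Proof. by move=> h c s cs; rewrite givensC; apply: h; rewrite sqrrN. Qed.

Lemma has_rotations_trans i j k : i != j -> j != k -> i != k ->
  has_rotations i j -> has_rotations j k -> has_rotations i k.
Proof.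
move=> ij jk ik Pij Pjk c s cs; rewrite (givens_conj c s ij jk ik).
apply: GM; first by apply: Pij; rewrite expr0n add0r expr1n.
by apply: GM; [exact: Pjk|apply: Pij; rewrite expr0n add0r sqrrN expr1n].
Qed.

Hypothesis Grot : forall i j, i != j -> has_rotations i j.

Definition fixed_columns (k : nat) (Y : 'M[R]_n) : Prop :=
  forall a l : 'I_n, (l < k)%N -> Y a l = (a == l)%:R.

Lemma SO_mulmxr (g Y : 'M[R]_n) : g *m g^T = 1%:M -> \det g = 1 ->
  SO_space R n Y -> SO_space R n (g *m Y).
Proof.
move=> gg dg [YY dY]; split; last by rewrite det_mulmx dg dY mulr1.
by rewrite trmx_mul -mulmxA (mulmxA Y) YY mul1mx.
Qed.

Lemma SO_cols Y (k l : 'I_n) : SO_space R n Y ->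
  \sum_a Y a k * Y a l = (k == l)%:R.
Proof.
move=> [/mulmx1C /matrixP /(_ k l) + _]; rewrite !mxE => <-.
by apply: eq_bigr => a _; rewrite mxE.
Qed.

(** Orthogonality already makes the entries of column [k] above the diagonal vanish.
Rotating the entries below into the diagonal one leaves a nonnegative diagonal
entry, which is 1 because the column has norm 1.  In the last column there is
nothing to rotate, and the sign comes from the determinant. *)
Lemma reach_SO_fixed_column (k : 'I_n) (Y : 'M[R]_n) : SO_space R n Y ->
  fixed_columns k Y -> exists Z, [/\ reach G Y Z, SO_space R n Z & fixed_columns k.+1 Z].
Proof.
move=> SY fY.
pose inv (Z : 'M[R]_n) := SO_space R n Z /\ fixed_columns k Z.
(* The sign condition in [zero] holds as soon as one rotation has been made. *)
pose zero (i : 'I_n) (Z : 'M[R]_n) := Z i k = 0 /\ 0 <= Z k k.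
pose s := [seq i : 'I_n <- enum 'I_n | (k < i)%N].
have step i Z : i \in s -> inv Z -> exists Z', [/\ reach G Z Z', inv Z', zero i Z' &
    forall j, j \in s -> j != i -> zero j Z -> zero j Z'].
  rewrite mem_filter mem_enum andbT => ki [SZ fZ].
  have ik : k != i by apply: contraTneq ki => ->; rewrite ltnn.
  pose r := Num.sqrt (Z k k ^+ 2 + Z i k ^+ 2).
  have r0 : 0 <= r by exact: sqrtr_ge0.
  have r2 : r ^+ 2 = Z k k ^+ 2 + Z i k ^+ 2 by rewrite sqr_sqrtr// addr_ge0 ?sqr_ge0.
  have [c [s' [cs rot1 rot2]]] : exists c s', [/\ c ^+ 2 + s' ^+ 2 = 1,
      c * Z k k + s' * Z i k = r & c * Z i k - s' * Z k k = 0].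
    have [rE|rn0] := eqVneq r 0.
      exists 1, 0; rewrite expr1n expr0n addr0 !mul1r !mul0r rE.
      move/eqP: r2; rewrite rE expr0n eq_sym paddr_eq0 ?sqr_ge0//.
      by rewrite !sqrf_eq0 => /andP[/eqP -> /eqP ->]; rewrite addr0 subr0.
    exists (Z k k / r), (Z i k / r); split.
    - by rewrite !expr_div_n -mulrDl -r2 divff// sqrf_eq0.
    - by rewrite mulrAC [X in _ + X]mulrAC -mulrDl -!expr2 -r2 expr2 mulfK.
    - by field.
  exists (givens k i c s' *m Z).
  have kk : (givens k i c s' *m Z) k k = r.
    by rewrite givens_mulE eqxx (negbTE ik) -rot1 /=; ring.
  have ii : (givens k i c s' *m Z) i k = 0.
    by rewrite givens_mulE eqxx eq_sym (negbTE ik) -rot2 /=; ring.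
  split.
  - by exists (givens k i c s') => //; apply: Grot.
  - split.
      by apply: SO_mulmxr => //; [exact: givens_orthogonal|exact: det_givens].
    move=> a l lk; rewrite givens_mulE !fZ//.
    have -> : (k == l) = false by apply: contraTF lk => /eqP ->; rewrite ltnn.
    have -> : (i == l) = false.
      by apply: contraTF lk => /eqP <-; rewrite -leqNgt ltnW.
    by rewrite /=; ring.
  - by rewrite /zero kk ii.
  - move=> j; rewrite mem_filter => /andP[kj _] ji [Zj _]; split; last by rewrite kk.
    rewrite givens_mulE Zj (negbTE ji).
    have -> : (j == k) = false by apply: contraTF kj => /eqP ->; rewrite ltnn.
    by rewrite /=; ring.
have [Z [YZ [SZ fZ] Z0]] :=
  clear_all (@reach_refl R n G G1 n) (@reach_trans R n G GM n) step (conj SY fY).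
exists Z; split => //.
have offdiag a : a != k -> Z a k = 0.
  move=> ak; case: (ltngtP a k) => [lt|gt|/val_inj]; last 1 first.
    by move/eqP; rewrite (negbTE ak).
    have := SO_cols a k SZ; rewrite (negbTE ak) (bigD1 a)//= fZ// eqxx mul1r.
    by rewrite big1 ?addr0// => b /negbTE ba; rewrite fZ// ba mul0r.
  by have [] := Z0 a; rewrite // mem_filter gt mem_enum.
have diag : Z k k = 1.
  have : Z k k ^+ 2 = 1.
    have := SO_cols k k SZ; rewrite eqxx (bigD1 k)//= big1 ?addr0//.
    by move=> b bk; rewrite offdiag// mul0r.
  move=> /eqP; rewrite sqrf_eq1 => /orP[/eqP//|/eqP Zkk].
  (* If some row lies below k, the eliminations made the entry nonnegative. *)
  have [kn|nk] := ltnP k.+1 n.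
    have [] := Z0 (Ordinal kn); first by rewrite mem_filter mem_enum /= ltnS leqnn.
    by move=> _; rewrite Zkk ler0N1.
  (* Otherwise Z is diagonal and its determinant is the entry -1. *)
  have fZ' a l : l != k -> Z a l = (a == l)%:R.
    move=> lk; apply: fZ; rewrite ltn_neqAle lk -ltnS.
    by apply: leq_trans nk.
  have [_ dZ] := SZ.
  have : is_trig_mx Z.
    apply/is_trig_mxP => a b ab; have [bk|bk] := eqVneq b k.
      by rewrite bk offdiag//; apply: contraTneq ab => ->; rewrite bk ltnn.
    by rewrite fZ'//; case: eqP ab => // ->; rewrite ltnn.
  move/det_trig; rewrite dZ (bigD1 k)//= Zkk big1 ?mulr1 => [//|l lk].
  by rewrite fZ'// eqxx.
move=> a l; rewrite ltnS leq_eqVlt => /orP[/eqP/val_inj ->|]; last exact: fZ.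
by have [->//|ak] := eqVneq a k; exact: offdiag.
Qed.

Lemma reach_SO_id (Y : 'M[R]_n) : SO_space R n Y -> reach G Y 1%:M.
Proof.
move=> SY.
suff: forall k : nat, (k <= n)%N ->
    exists Z, [/\ reach G Y Z, SO_space R n Z & fixed_columns k Z].
  move=> /(_ n (leqnn n))[Z [YZ _ fZ]].
  by suff <- : Z = 1%:M by []; apply/matrixP => a b; rewrite fZ// mxE.
elim=> [_|k IH kn]; first by exists Y; split => //; exact: reach_refl.
have [Z [YZ SZ fZ]] := IH (ltnW kn).
have [Z' [ZZ' SZ' fZ']] := @reach_SO_fixed_column (Ordinal kn) Z SZ fZ.
by exists Z'; split => //; exact: reach_trans YZ ZZ'.
Qed.

End givens.

(** * Disconnected graphs *)

Lemma connect_adjC (n m : nat) (e : 'I_m -> 'I_n * 'I_n) (i : 'I_n) (k : 'I_m) :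
  connect (graph_adj e) i (e k).1 = connect (graph_adj e) i (e k).2.
Proof.
have adj : graph_adj e (e k).1 (e k).2.
  by apply/existsP; exists k; rewrite -surjective_pairing eqxx.
have adj' : graph_adj e (e k).2 (e k).1.
  by apply/existsP; exists k; rewrite -surjective_pairing eqxx orbT.
by apply/idP/idP => /connect_trans; apply; apply: connect1.
Qed.

(** Left multiplication by this row sums the rows in the component of [i]. *)
Definition component_row (R : realType) (n m : nat) (e : 'I_m -> 'I_n * 'I_n)
  (i : 'I_n) : 'rV[R]_n := \row_a (connect (graph_adj e) i a)%:R.

Lemma component_row_Amx (R : realType) (n m : nat) (e : 'I_m -> 'I_n * 'I_n) i k :
  component_row R e i *m Amx R (e k).1 (e k).2 = 0.
Proof.
have E (p q : 'I_n) : component_row R e i *m delta_mx p q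
    = component_row R e i 0 p *: delta_mx 0 q.
  apply/rowP => b; rewrite !mxE (bigD1 p)//= !mxE eqxx /= big1 ?addr0//.
  by move=> c /negbTE cp; rewrite !mxE cp mulr0.
rewrite /Amx !mulmxBr mulmxDr !E !mxE connect_adjC.
by apply/rowP => b; rewrite !mxE; ring.
Qed.

(** If [j] lies outside the component of [i], column [j] of the identity vanishes on that
component, while a rotation with a nonzero entry (i, j) has positive energy there.
As such a rotation serves a 3-cycle that sends [i] to [j], an even permutation. *)
Lemma connected_of_SO_controllable (R : realType) (n m : nat) (e : 'I_m -> 'I_n * 'I_n) :
  (3 <= n)%N ->
  controllable_from (SO_space R n) (fun k => Omega R (e k).1 (e k).2) 1%:M ->
  graph_connected e.
Proof.
move=> n3 ctrl i j; apply/negPn/negP => nij.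
have ij : i != j by apply: contraNneq nij => ->; exact: connect0.
have [l li lj] : exists2 l, l != i & l != j.
  have : (0 < #|~: [set i; j]%SET|)%N.
    by rewrite -(ltn_add2l #|[set i; j]%SET|) cardsC card_ord cards2 ij addn0.
  case/card_gt0P => l; rewrite !inE negb_or => /andP[li lj].
  by exists l.
pose sigma := (tperm i j * tperm i l)%g.
have sigmai : sigma i = j by rewrite permM tpermL tpermD// eq_sym.
have SOs : SO_space R n (perm_mx sigma).
  split; first by rewrite tr_perm_mx -perm_mxM mulgV perm_mx1.
  by rewrite det_perm odd_permM !odd_tperm ij eq_sym li.
have := steerable_Omega_energy (w := fun a => (connect (graph_adj e) i a)%:R) j
  (fun k => congr1 (fun b : bool => b%:R) (connect_adjC e i k)) (ctrl _ SOs).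
rewrite big1 => [|a _]; last first.
  by rewrite mxE; have [->|_] := eqVneq a j; rewrite ?(negbTE nij) ?mul0r// expr0n mulr0.
rewrite (bigD1 i)//= connect0 mxE mxE sigmai eqxx expr1n mulr1 big1 ?addr0.
  by move/eqP; rewrite eq_sym oner_eq0.
move=> a ai; rewrite !mxE -sigmai (inj_eq perm_inj) (negbTE ai).
by rewrite expr0n mulr0.
Qed.

Lemma connected_of_simplex_controllable (R : realType) (n m : nat)
    (e : 'I_m -> 'I_n * 'I_n) :
  (3 <= n)%N ->
  controllable_on (simplex R n `\ uniform_distr R n)
    (fun k => Amx R (e k).1 (e k).2) -> graph_connected e.
Proof.
move=> n3 ctrl i j; apply/negPn/negP => nij.
have ij : i != j by apply: contraNneq nij => ->; exact: connect0.
have n0 : n%:R != 0 :> R by rewrite pnatr_eq0 -lt0n (leq_trans _ n3).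
have mem (p q : 'I_n) : p != q -> (simplex R n `\ uniform_distr R n) (delta_mx p 0).
  move=> pq; split.
    rewrite /simplex /= (bigD1 p)//= mxE !eqxx big1 ?addr0// => a /negbTE ap.
    by rewrite mxE ap.
  move=> /matrixP /(_ q 0); rewrite !mxE eq_sym (negbTE pq) => /eqP.
  by rewrite eq_sym invr_eq0 (negbTE n0).
have ji : j != i by rewrite eq_sym.
have := steerable_linear (component_row_Amx R e i) (ctrl _ _ (mem _ _ ij) (mem _ _ ji)).
move/matrixP => /(_ 0 0).
rewrite -!colE !mxE connect0 (negbTE nij) => /eqP.
by rewrite oner_eq0.
Qed.

(** Distinct first entries keep the agents apart, and the remaining entries make the
differences span the space. *)
Definition sample_row (R : realType) (d : nat) (k : nat) : 'rV[R]_d :=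
  \row_(l < d) if l == 0 :> nat then k%:R else (k == l.+1)%:R.

(** The rows are shifted to have sum zero, and permuted among the agents by [sigma]. *)
Definition sample_agents (R : realType) (n d : nat) (sigma : 'S_n) :
    'M[R]_(n, d) :=
  \matrix_(a, l) (sample_row R d (sigma a) 0 l
    - n%:R^-1 * \sum_(b < n) sample_row R d b 0 l).

Lemma sample_agentsP (R : realType) (n d : nat) (sigma : 'S_n) :
  (0 < d)%N -> (d.+1 < n)%N ->
  agent_space R n d (sample_agents R d sigma).
Proof.
move=> d0 dn; pose l0 : 'I_d := Ordinal d0.
have n0 : n%:R != 0 :> R by rewrite pnatr_eq0 -lt0n (leq_trans _ dn).
have rowB a b : row a (sample_agents R d sigma) - row b (sample_agents R d sigma)
    = sample_row R d (sigma a) - sample_row R d (sigma b).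
  by apply/rowP => l; rewrite !mxE opprB addrA subrK.
split.
- apply/rowP => l; rewrite summxE [RHS]mxE.
  have rowE a : row a (sample_agents R d sigma) 0 l = sample_row R d (sigma a) 0 l
      - n%:R^-1 * \sum_(b < n) sample_row R d b 0 l by rewrite mxE mxE.
  rewrite (eq_bigr _ (fun a _ => rowE a)).
  rewrite sumrB sumr_const card_ord -[X in _ - X]mulr_natl mulVKf//.
  rewrite [X in _ - X](reindex_inj (@perm_inj _ sigma)) /=.
  exact: subrr.
- move=> a b ab; apply: contra_neq ab => /eqP; rewrite -subr_eq0 rowB subr_eq0.
  move=> /eqP/rowP/(_ l0); rewrite !mxE /= => /eqP.
  by rewrite eqr_nat => /eqP/val_inj/perm_inj.
- move=> i0 _; set U := span _.
  have Ui0 b : row i0 (sample_agents R d sigma) - row b (sample_agents R d sigma) \in U.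
    have [->|bi] := eqVneq b i0; first by rewrite subrr mem0v.
    by apply/memv_span/mapP; exists b; rewrite // mem_filter bi mem_enum.
  have Ub p q : (p < n)%N -> (q < n)%N -> sample_row R d p - sample_row R d q \in U.
    move=> pn qn.
    have -> : sample_row R d p - sample_row R d q
        = (row i0 (sample_agents R d sigma)
            - row ((sigma^-1)%g (Ordinal qn)) (sample_agents R d sigma))
          - (row i0 (sample_agents R d sigma)
            - row ((sigma^-1)%g (Ordinal pn)) (sample_agents R d sigma)).
      by rewrite !rowB !permKV /= opprB [RHS]addrC addrA subrK.
    by rewrite memvB.
  have n1 : (1 < n)%N := leq_ltn_trans d0 (ltnW dn).
  have e0 : delta_mx 0 l0 \in U.
    suff -> : delta_mx 0 l0 = sample_row R d 1 - sample_row R d 0.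
      exact: Ub n1 (ltnW n1).
    apply/rowP => l; rewrite !mxE eqxx /=.
    have [l00|ln0] := eqVneq (l : nat) 0%N.
      by rewrite -val_eqE /= l00 eqxx subr0.
    by rewrite -val_eqE /= (negbTE ln0) eq_sym eqSS (negbTE ln0) subr0.
  have el l : delta_mx 0 l \in U.
    have [->//|ll0] := eqVneq l l0.
    have ln : (l.+1 < n)%N := leq_ltn_trans (ltn_ord l) (ltnW dn).
    suff -> : delta_mx 0 l
        = sample_row R d l.+1 - sample_row R d 0 - l.+1%:R *: delta_mx 0 l0.
      exact: memvB (Ub _ _ ln (ltnW n1)) (memvZ _ e0).
    apply/rowP => l'; rewrite !mxE eqxx /= -!val_eqE /=.
    have [l00|ln0] := eqVneq (l' : nat) 0%N.
      move: ll0; rewrite -val_eqE l00 /= subr0 mulr1 subrr eq_sym.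
      by move=> /negbTE ->.
    by rewrite mulr0 !subr0 eqSS eq_sym.
  apply/eqP; rewrite eqEsubv subvf /=; apply/subvP => v _.
  rewrite [v]row_sum_delta; apply: memv_suml => l _; exact: memvZ.
Qed.

(** Exchanging agents [i] and [j] changes the sum over the component of [i] by the
difference of their positions. *)
Lemma connected_of_agents_controllable (R : realType) (n m : nat)
    (e : 'I_m -> 'I_n * 'I_n)
    (d : nat) :
  (0 < d)%N -> (d.+1 < n)%N ->
  controllable_on (agent_space R n d) (fun k => Amx R (e k).1 (e k).2) ->
  graph_connected e.
Proof.
move=> d0 dn ctrl i j; apply/negPn/negP => nij.
have ij : i != j by apply: contraNneq nij => ->; exact: connect0.
have := steerable_linear (component_row_Amx R e i)
  (ctrl _ _ (sample_agentsP R 1%g d0 dn) (sample_agentsP R (tperm i j) d0 dn)).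
move/matrixP => /(_ 0 (Ordinal d0)); rewrite !mxE.
rewrite (bigD1 i)//= [RHS](bigD1 i)//= => /eqP.
set s1 := (X in _ + X == _); set s2 := (X in _ == _ + X).
(* Among the other agents only j is moved, and it has weight zero. *)
have -> : s1 = s2.
  apply: eq_bigr => a ai; rewrite !mxE; have [->|aj] := eqVneq a j.
    by rewrite (negbTE nij) !mul0r.
  by rewrite perm1 tpermD// eq_sym.
rewrite (inj_eq (addIr s2)) !mxE connect0 !mul1r (inj_eq (addIr _)) perm1 tpermL /=.
by rewrite eqr_nat => /eqP/val_inj/eqP; rewrite (negbTE ij).
Qed.

(** * Connected graphs *)

Lemma SO_controllable_of_connected (R : realType) (n m : nat) (e : 'I_m -> 'I_n * 'I_n) :
  (forall k, (e k).1 != (e k).2) -> graph_connected e ->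
  controllable_from (SO_space R n) (fun k => Omega R (e k).1 (e k).2) 1%:M.
Proof.
move=> ne conn Y SY.
pose S (a : 'M[R]_n) := exists k c, a = givens (e k).1 (e k).2 (cos c) (sin c).
have Sinv a : S a -> exists2 b, S b & b *m a = 1%:M.
  move=> [k [c ->]]; exists (givens (e k).1 (e k).2 (cos (- c)) (sin (- c))).
    by exists k, (- c).
  rewrite cosN sinN -tr_givens; apply: mulmx1C; apply: givens_orthogonal => //.
  exact: cos2Dsin2.
have rotations : forall i j, i != j -> has_rotations (monoid_gen S) i j.
  apply: (connected_pairs _ _ _ conn) => [k c s cs||].
  - have [t [-> ->]] := unit_circle cs.
    rewrite -[givens _ _ _ _]mulmx1; apply: monoid_genM; last exact: monoid_gen1.
    by exists k, t.
  - by move=> i j; exact: has_rotationsC.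
  - by move=> i j k ij jk ik; apply: has_rotations_trans => //; exact: monoid_gen_mul.
have [g Gg gY] := reach_SO_id (@monoid_gen1 _ _ S) (@monoid_gen_mul _ _ S) rotations SY.
have [h Gh hg] := monoid_gen_inv Sinv Gg.
have -> : Y = h *m 1%:M by rewrite -gY mulmxA hg mul1mx.
by apply: (steerable_monoid_gen (fun k => Omega_flow R (ne k))).
Qed.

Section symmetric.
Variables (R : realType) (n m : nat) (e : 'I_m -> 'I_n * 'I_n).
Hypothesis ne : forall k, (e k).1 != (e k).2.

Definition edge_scaling (a : 'M[R]_n) : Prop :=
  exists k c, a = scaling (e k).1 (e k).2 (expR (-2 * c)).

Lemma edge_scaling_reach (d : nat) (X Y : 'M[R]_(n, d)) :
  graph_connected e -> (d.+1 < n)%N ->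
  centered X -> trivial_ker X -> centered Y -> trivial_ker Y ->
  reach (monoid_gen edge_scaling) X Y.
Proof.
move=> conn dn cX kX cY kY.
have Sinv a : edge_scaling a -> exists2 b, edge_scaling b & b *m a = 1%:M.
  move=> [k [c ->]]; exists (scaling (e k).1 (e k).2 (expR (-2 * (- c)))).
    by exists k, (- c).
  by rewrite scalingM// -expRD mulrN addNr expR0 scaling1.
have scalings i j : i != j -> has_scalings (monoid_gen edge_scaling) i j.
  apply: (connected_pairs _ _ _ conn) => [k s s0||].
  - rewrite -[scaling _ _ _]mulmx1; apply: monoid_genM; last exact: monoid_gen1.
    exists k, (- ln s / 2); have -> : -2 * (- ln s / 2) = ln s by field.
    by rewrite lnK.
  - by move=> i' j'; exact: has_scalingsC.
  - by move=> i' j' k ij jk ik; apply: has_scalings_trans => //; exact: monoid_gen_mul.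
pose o : 'I_n := Ordinal (ltn_trans (ltn0Sn d) dn).
pose rho (l : 'I_d) : 'I_n := Ordinal (leq_ltn_trans (ltn_ord l) (ltnW dn)).
apply: (@frames_transitive R n (monoid_gen edge_scaling) _ _ scalings _ d o
  (Ordinal dn) rho) => //.
- exact: monoid_gen1.
- exact: monoid_gen_mul.
- by move=> g; apply: monoid_gen_inv.
- by move=> l l' /(congr1 val) /= [] /val_inj.
- by move=> l; rewrite -val_eqE /= eqSS gtn_eqF.
Qed.

Lemma reach_steerable (p : nat) (X Y : 'M[R]_(n, p)) :
  reach (monoid_gen edge_scaling) X Y ->
  steerable (fun k => Amx R (e k).1 (e k).2) X Y.
Proof.
by move=> [g Gg <-]; apply: (steerable_monoid_gen (fun k => Amx_flow R (ne k))).
Qed.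

(** The directions e_i - e_j are orthogonal to the constant vectors. *)
Lemma edge_scaling_const (p : nat) (x : R) (g : 'M[R]_n) :
  monoid_gen edge_scaling g -> g *m (const_mx x : 'M[R]_(n, p)) = const_mx x.
Proof.
elim=> [|_ {}g [k [c ->]] _ IH]; first by rewrite mul1mx.
rewrite -mulmxA IH mulmxDl mul1mx -scalemxAl.
suff -> : Amx R (e k).1 (e k).2 *m (const_mx x : 'M[R]_(n, p)) = 0.
  by rewrite scaler0 addr0.
apply/matrixP => a b; rewrite /Amx !mulmxBl mulmxDl.
have BE (A B : 'M[R]_(n, p)) : (A - B) a b = A a b - B a b by rewrite !mxE.
have DE (A B : 'M[R]_(n, p)) : (A + B) a b = A a b + B a b by rewrite !mxE.
by rewrite !BE DE !delta_mulmxE !mxE; ring.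
Qed.

Lemma simplex_controllable_of_connected : (3 <= n)%N -> graph_connected e ->
  controllable_on (simplex R n `\ uniform_distr R n)
    (fun k => Amx R (e k).1 (e k).2).
Proof.
move=> n3 conn x y [sx xu] [sy yu].
have n0 : n%:R != 0 :> R by rewrite pnatr_eq0 -lt0n (leq_trans _ n3).
have cent z : simplex R n z -> centered (z - uniform_distr R n).
  move=> sz; apply/matrixP => a b; rewrite !ord1 !mxE.
  under eq_bigr do rewrite !mxE mul1r.
  by rewrite sumrB sz sumr_const card_ord -[_ *+ n]mulr_natr mulVf// subrr.
have ker z : z <> uniform_distr R n -> trivial_ker (z - uniform_distr R n).
  move=> zu v zv; apply/matrixP => a b; rewrite !ord1 mxE; apply/eqP/negPn/negP => v0.
  apply: zu; apply/subr0_eq/matrixP => c f; rewrite !ord1 [RHS]mxE.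
  move/matrixP: zv => /(_ c 0); rewrite [LHS]mxE big_ord1 [RHS]mxE => /eqP.
  by rewrite mulf_eq0 (negbTE v0) orbF => /eqP.
have [g Gg gxy] :=
  edge_scaling_reach conn n3 (cent _ sx) (ker _ xu) (cent _ sy) (ker _ yu).
apply: reach_steerable; exists g => //.
by rewrite -[x](subrK (uniform_distr R n)) mulmxDr gxy edge_scaling_const// subrK.
Qed.

(** A vector annihilated by all the agents is orthogonal to their differences, which
span the space; so the columns are linearly independent. *)
Lemma agents_controllable_of_connected (d : nat) : (d.+1 < n)%N -> graph_connected e ->
  controllable_on (agent_space R n d) (fun k => Amx R (e k).1 (e k).2).
Proof.
move=> dn conn X Y.
have cent Z : agent_space R n d Z -> centered Z.
  move=> [sZ _ _]; apply/rowP => l; move/rowP: sZ => /(_ l).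
  rewrite summxE !mxE => sZl; rewrite -[RHS]sZl.
  by apply: eq_bigr => a _; rewrite !mxE mul1r.
have ker Z : agent_space R n d Z -> trivial_ker Z.
  move=> [_ _ /(_ (Ordinal (ltn_trans (ltn0Sn d) dn)) erefl) full] v Zv.
  set i0 := Ordinal _ in full.
  have sub : (fullv <= lker (linfun (mulmxr v : 'rV[R]_d -> 'rV[R]_1)))%VS.
    rewrite -full; apply/span_subvP => _ /mapP[j _ ->].
    by rewrite memv_ker lfunE /= mulmxBl -!row_mul Zv !row0 subrr.
  apply/matrixP => l b; rewrite !ord1.
  have := subvP sub (delta_mx 0 l) (memvf _).
  by rewrite memv_ker lfunE /= -rowE => /eqP/matrixP/(_ 0 0); rewrite !mxE.
by move=> sX sY; apply/reach_steerable/edge_scaling_reach; auto.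
Qed.

End symmetric.

(** * The controllability criterion *)

Theorem theorem6 (R : realType) (n m : nat) (e : 'I_m -> 'I_n * 'I_n) :
  [/\ (3 <= n)%N ->
      (forall k : 'I_m, ((e k).1 < (e k).2)%N) ->
      (controllable_from (SO_space R n)
         (fun k : 'I_m => Omega R (e k).1 (e k).2) 1%:M
       <-> graph_connected e),
      forall d : nat, (0 < d)%N -> (d.+1 < n)%N ->
      (forall k : 'I_m, (e k).1 != (e k).2) ->
      (controllable_on (agent_space R n d)
         (fun k : 'I_m => Amx R (e k).1 (e k).2)
       <-> graph_connected e)
    & (3 <= n)%N ->
      (forall k : 'I_m, (e k).1 != (e k).2) ->
      (controllable_on (simplex R n `\ uniform_distr R n)
         (fun k : 'I_m => Amx R (e k).1 (e k).2)
       <-> graph_connected e)].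
Proof.
split=> [n3 lt|d d0 dn ne|n3 ne]; split.
- exact: connected_of_SO_controllable.
- by apply: SO_controllable_of_connected => k; rewrite -val_eqE (ltn_eqF (lt k)).
- exact: connected_of_agents_controllable.
- exact: agents_controllable_of_connected.
- exact: connected_of_simplex_controllable.
- exact: simplex_controllable_of_connected.
Qed.
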